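(* Consider $\min_{x\in\mathbb{R}^d} f(x)$ with $f=\frac1n\sum_{i=1}^n f_i$ and $f_i(x)=\mathbb{E}_{\xi_i\sim\mathcal{D}_i}[f_i(x;\xi_i)]$. Assume: (i) every compressor $\mathcal{C}_i^t$ is $\alpha$-contractive with a common $\alpha\in(0,1]$; (ii) $f^{\inf}:=\inf_{x\in\mathbb{R}^d} f(x)>-\infty$; (iii) for each $i$ there is $L_i>0$ with $\|\nabla f_i(x)-\nabla f_i(y)\|\le L_i\|x-y\|$ for all $x,y\in\mathbb{R}^d$; (iv) there is $L>0$ with $\|\nabla f(x)-\nabla f(y)\|\le L\|x-y\|$ for all $x,y\in\mathbb{R}^d$; (v) for all $i$ and all $x\in\mathbb{R}^d$: $\mathbb{E}[\nabla f_i(x;\xi_i)]=\nabla f_i(x)$ and $\mathbb{E}\|\nabla f_i(x;\xi_i)-\nabla f_i(x)\|^2\le\sigma_g^2$, and also $\mathbb{E}[\nabla^2 f_i(x;\xi_i)]=\nabla^2 f_i(x)$ and $\mathbb{E}\|\nabla^2 f_i(x;\xi_i)-\nabla^2 f_i(x)\|^2\le\sigma_h^2$. Let $\gamma_0>0$ and $$\eta_t=\left(\frac{2}{t+2}\right)^{1/2},\qquad \gamma_t=\gamma_0\left(\frac{2}{t+2}\right)^{3/4}.$$ Then for every $T\ge1$ the iterates $\{x^t\}$ of the algorithm $\|\text{EF21-SGDM}\|$ satisfy $$\mathbb{E}\big[\|\nabla f(\tilde x^T)\|\big]=\widetilde{\mathcal{O}}\left(\frac{V_0/\gamma_0+\gamma_0\left(L+\bar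 L/\alpha^2\right)+\sigma_g\left(1/\sqrt n+1/\alpha^2\right)}{T^{1/4}}\right),$$ where $\tilde x^T$ is chosen at random from $\{x^0,\dots,x^{T-1}\}$, equal to $x^t$ with probability $\gamma_t/\sum_{s=0}^{T-1}\gamma_s$, and $\bar L=\frac1n\sum_{i=1}^nL_i$.
   Context: $\|\cdot\|$ is the Euclidean norm for vectors and the spectral norm for matrices. A possibly randomized map $\mathcal{C}:\mathbb{R}^d\to\mathbb{R}^d$ is $\alpha$-contractive if $\mathbb{E}\|\mathcal{C}(v)-v\|^2\le(1-\alpha)\|v\|^2$ for all $v\in\mathbb{R}^d$. Algorithm $\|\text{EF21-SGDM}\|$. Inputs: $x^0\in\mathbb{R}^d$ and $g_i^0,v_i^0\in\mathbb{R}^d$ for $i=1,\dots,n$ (deterministic), stepsizes $\gamma_t>0$, momentum parameters $\eta_t\in(0,1]$, compressors $\mathcal{C}_i^t$. For $t=0,1,2,\dots$, with $g^t=\frac1n\sum_{i=1}^n g_i^t$: $$x^{t+1}=x^t-\gamma_t\frac{g^t}{\|g^t\|},\qquad v_i^{t+1}=(1-\eta_t)v_i^t+\eta_t\nabla f_i(x^{t+1};\xi_i^{t+1}),\qquad g_i^{t+1}=g_i^t+\mathcal{C}_i^{t+1}(v_i^{t+1}-g_i^t).$$ If $g^t=0$, the quotient $g^t/\|g^t\|$ is read as $0$. The samples $\xi_i^{t+1}\sim\mathcal{D}_i$ are independent across clients $i$ and iterations $t$ and independent of everything generated earlier; the randomness of the compressor $\mathcal{C}_i^{t+1}$ is fresh,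 i.e. independent of its input and of the past. $\displaystyle V_0=f(x^0)-f^{\inf}+\frac{2\gamma_0}{1-\sqrt{1-\alpha}}\cdot\frac1n\sum_{i=1}^n\|g_i^0-v_i^0\|+\frac{2\gamma_0\sqrt{1-\alpha}}{1-\sqrt{1-\alpha}}\cdot\frac1n\sum_{i=1}^n\|v_i^0-\nabla f_i(x^0)\|.$ $A_T=\widetilde{\mathcal{O}}(B_T)$ means that there are universal numerical constants $C>0$, $p\ge0$ (independent of the problem, of the algorithm's inputs, and of $T$) such that $A_T\le C(1+\log(T+1))^pB_T$ for all $T\ge1$. The functions $f_i$ and $f_i(\cdot;\xi_i)$ are as smooth as needed for the gradients and Hessians that appear to exist. *)

(* Defs.v *)
From HB Require Import structures.
From mathcomp Require Export all_boot all_order all_algebra.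
From mathcomp Require Export all_classical all_reals all_analysis.

Set Implicit Arguments.
Unset Strict Implicit.
Unset Printing Implicit Defensive.

Import Order.TTheory GRing.Theory Num.Theory.
Import numFieldNormedType.Exports.

Local Open Scope classical_set_scope.
Local Open Scope ring_scope.

(* The library's norm `|v| on matrices is the max norm, hence the following. *)
Definition enorm (R : realType) (d : nat) (v : 'rV[R]_d) : R :=
  Num.sqrt (\sum_(j < d) v 0 j ^+ 2).

(* Matrices act on row vectors from the right, as in the library's jacobian. *)
Definition spectral_norm (R : realType) (d : nat) (A : 'M[R]_d) : R :=
  sup [set enorm (v *m A) | v in [set v : 'rV[R]_d | enorm v <= 1]].

Definition grad (R : realType) (d : nat) (f : 'rV[R]_d -> R) (x : 'rV[R]_d) :
    'rV[R]_d :=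
  \row_(j < d) 'D_(delta_mx 0 j) f x.

Definition hess (R : realType) (d : nat) (f : 'rV[R]_d -> R) (x : 'rV[R]_d) :
    'M[R]_d :=
  jacobian (grad f) x.

Definition twice_differentiable (R : realType) (d : nat)
    (f : 'rV[R]_d -> R) : Prop :=
  forall x, differentiable f x /\ differentiable (grad f) x.

Definition grad_lipschitz (R : realType) (d : nat) (L : R)
    (f : 'rV[R]_d -> R) : Prop :=
  forall x y, enorm (grad f x - grad f y) <= L * enorm (x - y).

Definition avg (R : realType) (V : lmodType R) (n : nat) (u : 'I_n -> V) : V :=
  n%:R^-1 *: \sum_(i < n) u i.

Definition avgR (R : realType) (n : nat) (u : 'I_n -> R) : R :=
  n%:R^-1 * \sum_(i < n) u i.

(* The sigma-algebra generated by the coordinates, i.e. the Borel sets of R^d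
   (the library puts no measurable structure on matrices). *)
Definition borel_rV (R : realType) (d : nat) :=
  g_sigma_algebraType
    (g_sigma_preimage (fun (j : 'I_d) (v : 'rV[R]_d) => v 0 j)).

(* Entrywise mean of a random matrix; integrability is part of the claim. *)
Definition has_mean (R : realType) (dT : measure_display)
    (T : measurableType dT) (P : probability T R) (m n : nat)
    (M : T -> 'M[R]_(m, n)) (A : 'M[R]_(m, n)) : Prop :=
  forall i j, P.-integrable setT (fun w => (M w i j)%:E) /\
    ('E_P[fun w => M w i j] = (A i j)%:E)%E.

(* A randomized map is a map c with an auxiliary seed of law Q. *)
Definition contractive (R : realType) (d : nat) (alpha : R)
    (dZ : measure_display) (Z : measurableType dZ) (Q : probability Z R)
    (c : Z -> 'rV[R]_d -> 'rV[R]_d) : Prop :=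
  forall v : 'rV[R]_d,
    ('E_Q[fun z => (enorm (c z v - v) ^+ 2)%R]
      <= ((1 - alpha) * enorm v ^+ 2)%:E)%E.

Definition sigma_of (Omega : Type) (dT : measure_display)
    (T : measurableType dT) (X : Omega -> T) : set (set Omega) :=
  preimage_set_system setT X measurable.

Definition has_law (R : realType) (dO : measure_display)
    (Omega : measurableType dO) (P : probability Omega R)
    (dT : measure_display) (T : measurableType dT)
    (X : Omega -> T) (D : probability T R) : Prop :=
  measurable_fun setT X /\
  forall A : set T, measurable A -> P (X @^-1` A) = D A.

Definition independent (R : realType) (dO : measure_display)
    (Omega : measurableType dO) (P : probability Omega R)
    (F G : set (set Omega)) : Prop :=
  forall A B, F A -> G B -> (P (A `&` B) = P A * P B)%E.

(* Independence of the family X_1, ..., X_n and the sigma-algebra G. *)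
Definition independent_family (R : realType) (dO : measure_display)
    (Omega : measurableType dO) (P : probability Omega R) (n : nat)
    (dT : 'I_n -> measure_display) (T : forall i, measurableType (dT i))
    (X : forall i, Omega -> T i) (G : set (set Omega)) : Prop :=
  forall (A : forall i, set (T i)) (B : set Omega),
    (forall i, measurable (A i)) -> G B ->
    (P ((\bigcap_(i in [set: 'I_n]) (X i @^-1` A i)) `&` B)
      = (\prod_(i < n) P (X i @^-1` A i)) * P B)%E.

Record state (R : realType) (n d : nat) := State {
  pos : 'rV[R]_d;
  mom : 'I_n -> 'rV[R]_d;
  est : 'I_n -> 'rV[R]_d
}.

(* If g = 0 then (enorm g)^-1 *: g = 0. *)
Definition ef21_step (R : realType) (n d : nat) (gamma eta : R)
    (G c : 'I_n -> 'rV[R]_d -> 'rV[R]_d) (s : state R n d) : state R n d :=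
  let g := avg (est s) in
  let x' := pos s - gamma *: ((enorm g)^-1 *: g) in
  let v' := fun i => (1 - eta) *: mom s i + eta *: G i x' in
  State x' v' (fun i => est s i + c i (v' i - est s i)).

(* G t i is the stochastic gradient oracle and c t i the realized compressor
   of client i producing the state of index t; index 0 is not used. *)
Fixpoint ef21_run (R : realType) (n d : nat) (gamma eta : nat -> R)
    (x0 : 'rV[R]_d) (v0 g0 : 'I_n -> 'rV[R]_d)
    (G c : nat -> 'I_n -> 'rV[R]_d -> 'rV[R]_d) (t : nat) : state R n d :=
  if t is t'.+1 then
    ef21_step (gamma t') (eta t') (G t) (c t)
      (ef21_run gamma eta x0 v0 g0 G c t')
  else State x0 v0 g0.

Definition ef21_sgdm (R : realType) (n d : nat) (gamma eta : nat -> R)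
    (x0 : 'rV[R]_d) (v0 g0 : 'I_n -> 'rV[R]_d)
    (X : 'I_n -> Type) (F : forall i, X i -> 'rV[R]_d -> R)
    (Z : nat -> 'I_n -> Type) (c : forall t i, Z t i -> 'rV[R]_d -> 'rV[R]_d)
    (Omega : Type) (xi : nat -> forall i, Omega -> X i)
    (zeta : forall t i, Omega -> Z t i) (t : nat) (w : Omega) : state R n d :=
  ef21_run gamma eta x0 v0 g0
    (fun s i => grad (F i (xi s i w))) (fun s i => c s i (zeta s i w)) t.

(* All the randomness drawn in the first t iterations. *)
Definition history (Omega : Type) (n : nat)
    (dX : 'I_n -> measure_display) (X : forall i, measurableType (dX i))
    (dZ : nat -> 'I_n -> measure_display)
    (Z : forall t i, measurableType (dZ t i))
    (xi : nat -> forall i, Omega -> X i) (zeta : forall t i, Omega -> Z t i)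
    (t : nat) : set (set Omega) :=
  <<s [set A | exists s i, (1 <= s <= t)%N /\
                 (sigma_of (xi s i) A \/ sigma_of (zeta s i) A)] >>.

Definition eta_sched (R : realType) (t : nat) : R := (2 / t.+2%:R) `^ (1 / 2).

Definition gamma_sched (R : realType) (gamma0 : R) (t : nat) : R :=
  gamma0 * (2 / t.+2%:R) `^ (3 / 4).

Definition V0 (R : realType) (n d : nat) (alpha gamma0 : R)
    (fi : 'I_n -> 'rV[R]_d -> R)
    (x0 : 'rV[R]_d) (v0 g0 : 'I_n -> 'rV[R]_d) : R :=
  let f x := avgR (fi^~ x) in
  let q := Num.sqrt (1 - alpha) in
  f x0 - inf (range f)
  + 2 * gamma0 / (1 - q) * avgR (fun i => enorm (g0 i - v0 i))
  + 2 * gamma0 * q / (1 - q) * avgR (fun i => enorm (v0 i - grad (fi i) x0)).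

(* Main.v *)
(* Write [u_t = (2/(t+2))^(1/4)], so that [eta_t = u_t^2] and
   [gamma_t = gamma0 u_t^3]. The descent lemma for a normalized step costs
   [2 gamma_t |grad f(x^t) - g^t|], and this error splits into the momentum error
   [V_t = avg_i v_i^t - grad f(x^t)] and the average of the compression errors
   [W_{t,i} = |g_i^t - v_i^t|]. Since [eta_0 = 1], the momentum [v_i^1] is a fresh
   stochastic gradient and does not remember [v_i^0]. Hence
   - [E |v_i^t - grad f_i(x^t)| <= sigma_g + L_i gamma0] for [t >= 1];
   - [E W_{t,i}] contracts by [q = sqrt (1 - alpha)] at each step, up to
     [q eta_t (2 sigma_g + 2 L_i gamma0)], and [sum_t gamma_t eta_t] is at most
     logarithmic;
   - [E |V_t|^2 <= 2 eta_t (sigma_g^2/n + L^2 gamma0^2)] for [t >= 1], because the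
     noises of the clients are centered given the past, and
     [gamma_t sqrt eta_t = gamma0 u_t^4] sums to a logarithm.
   As [sum_(t < T) gamma_t >= gamma0 T^(1/4)], the bound follows with exponent
   [p = 1]. The first step is treated apart, as [V0] does not control
   [v_i^0 - grad f_i(x^0)] when [q = 0]: there
   [gamma0 |grad f(x^0)| <= f(x^0) - inf f + L gamma0^2] is used instead. *)

Require Import Defs.
From HB Require Import structures.
From mathcomp Require Import all_boot all_order all_algebra.
From mathcomp Require Import all_classical all_reals all_analysis.
From mathcomp Require Import measurable_realfun ring lra.

Set Implicit Arguments.
Unset Strict Implicit.
Unset Printing Implicit Defensive.

Import Order.TTheory GRing.Theory Num.Theory.
Import numFieldNormedType.Exports.

Local Open Scope classical_set_scope.
Local Open Scope ring_scope.

(** * Euclidean norm and averages *)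

(** The exponents of the schedules are tied together by the second-moment recursion of the averaged
    momentum error. With Young's parameter equal to [eta_t], one step multiplies it by (1 - eta)^2
    (1 + eta), roughly 1 - eta, and adds a noise of order eta^2 and a drift of order gamma^2 / eta,
    which is again of order eta^2 because gamma^2 = gamma0^2 eta^3. A multiple of [eta_t] is then
    invariant, provided that [eta_t] shrinks by at most a factor 1 - eta^2 / 2 per step. Second
    moments are needed there to gain 1/n. The errors of single clients are followed in first moment,
    where the compressor contracts by q; their momentum errors need not vanish, since they enter the
    compression error multiplied by [eta_t].

    Gradients and compressors are evaluated at random points. Instead of conditional expectations,
    the fresh randomness and the past are given a product law, and the past is frozen by Tonelli's
    theorem. Moments are integrals of nonnegative functions in the extended reals, so that
    integrability matters only for the centered cross terms. *)

Section Euclidean.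
Context {R : realType}.

Section Norm.
Context {d : nat}.
Implicit Types u v w : 'rV[R]_d.

Definition dot u v : R := \sum_(j < d) u 0 j * v 0 j.

Lemma dotC u v : dot u v = dot v u.
Proof. by apply: eq_bigr => j _; rewrite mulrC. Qed.

Lemma dotDr u v w : dot u (v + w) = dot u v + dot u w.
Proof. by rewrite -big_split; apply: eq_bigr => j _; rewrite mxE mulrDr. Qed.

Lemma dotDl u v w : dot (u + v) w = dot u w + dot v w.
Proof. by rewrite dotC dotDr !(dotC w). Qed.

Lemma dotZr a u v : dot u (a *: v) = a * dot u v.
Proof. by rewrite mulr_sumr; apply: eq_bigr => j _; rewrite mxE mulrCA. Qed.

Lemma dotZl a u v : dot (a *: u) v = a * dot u v.
Proof. by rewrite dotC dotZr dotC. Qed.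

Lemma dotNr u v : dot u (- v) = - dot u v.
Proof. by rewrite -scaleN1r dotZr mulN1r. Qed.

Lemma dotBl u v w : dot (u - v) w = dot u w - dot v w.
Proof. by rewrite dotDl -scaleN1r dotZl mulN1r. Qed.

Lemma enorm_ge0 u : 0 <= enorm u. Proof. exact: sqrtr_ge0. Qed.

Lemma enorm_sqr u : enorm u ^+ 2 = dot u u.
Proof.
rewrite sqr_sqrtr; last by apply: sumr_ge0 => j _; exact: sqr_ge0.
by apply: eq_bigr => j _; rewrite expr2.
Qed.

Lemma enorm0 : enorm (0 : 'rV[R]_d) = 0.
Proof. by rewrite /enorm big1 ?sqrtr0// => j _; rewrite mxE expr0n. Qed.

Lemma enorm_eq0 u : enorm u = 0 -> u = 0.
Proof.
move=> u0; have : \sum_(j < d) u 0 j ^+ 2 = 0.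
  transitivity (enorm u ^+ 2); last by rewrite u0 expr0n.
  by rewrite enorm_sqr; apply: eq_bigr => j _; rewrite expr2.
move/eqP; rewrite psumr_eq0 => [/allP h|j _]; last exact: sqr_ge0.
apply/rowP => j; rewrite mxE; apply/eqP; rewrite -sqrf_eq0.
by have := h j (mem_index_enum _).
Qed.

Lemma enormZ a u : enorm (a *: u) = `|a| * enorm u.
Proof.
rewrite -sqrtr_sqr -sqrtrM ?sqr_ge0// mulr_sumr.
by congr Num.sqrt; apply: eq_bigr => j _; rewrite mxE exprMn.
Qed.

Lemma enormN u : enorm (- u) = enorm u.
Proof. by rewrite -scaleN1r enormZ normrN normr1 mul1r. Qed.

Lemma enormB u v : enorm (u - v) = enorm (v - u).
Proof. by rewrite -enormN opprB. Qed.

Lemma enorm_sqrD u v :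
  enorm (u + v) ^+ 2 = enorm u ^+ 2 + 2 * dot u v + enorm v ^+ 2.
Proof. by rewrite !enorm_sqr dotDl !dotDr (dotC v u); ring. Qed.

(** Cauchy-Schwarz: the squared norm of |v| u - |u| v equals 2 |u| |v| (|u| |v| - dot u v).
    Cancelling |u| |v| requires it to be nonzero, hence the case split. *)
Lemma dot_le u v : dot u v <= enorm u * enorm v.
Proof.
have [/eqP|ab0] := boolP (enorm u * enorm v == 0).
  move=> h; rewrite h; move/eqP: h; rewrite mulf_eq0.
  by case/orP => /eqP/enorm_eq0 ->; rewrite /dot big1// => j _; rewrite mxE ?mul0r ?mulr0.
have ab : 0 < enorm u * enorm v.
  by rewrite lt_neqAle eq_sym ab0 mulr_ge0 ?enorm_ge0.
have : 0 <= enorm (enorm v *: u - enorm u *: v) ^+ 2 by exact: sqr_ge0.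
rewrite enorm_sqrD enormN !enormZ dotNr dotZl dotZr !ger0_norm ?enorm_ge0//.
move=> H; suff : enorm u * enorm v * dot u v <= enorm u * enorm v * (enorm u * enorm v).
  by rewrite ler_pM2l.
by move: H; nra.
Qed.

Lemma ler_enormD u v : enorm (u + v) <= enorm u + enorm v.
Proof.
rewrite -(@ler_pXn2r _ 2)// ?nnegrE ?addr_ge0 ?enorm_ge0// enorm_sqrD sqrrD.
have := dot_le u v; lra.
Qed.

Lemma ler_enormB u v w : enorm (u - w) <= enorm (u - v) + enorm (v - w).
Proof. by rewrite -{1}(subrK v u) -addrA ler_enormD. Qed.

(** Young's inequality. It is applied with e = [eta_t], so that the loss 1 + e is absorbed by the
    factor (1 - eta_t)^2 of the momentum update. *)
Lemma enorm_sqrD_young (e : R) u v : 0 < e ->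
  enorm (u + v) ^+ 2 <= (1 + e) * enorm u ^+ 2 + (1 + e^-1) * enorm v ^+ 2.
Proof.
move=> e0; rewrite enorm_sqrD.
have := dot_le u v; set a := enorm u; set b := enorm v => dab.
suff : 2 * (a * b) <= e * a ^+ 2 + e^-1 * b ^+ 2 by lra.
have -> : e * a ^+ 2 + e^-1 * b ^+ 2 = 2 * (a * b) + e^-1 * (e * a - b) ^+ 2.
  by field; rewrite gt_eqF.
by rewrite lerDl mulr_ge0 ?sqr_ge0// invr_ge0 ltW.
Qed.

Lemma enorm_sum (I : Type) (r : seq I) (u : I -> 'rV[R]_d) :
  enorm (\sum_(i <- r) u i) <= \sum_(i <- r) enorm (u i).
Proof.
elim: r => [|i r IH]; first by rewrite !big_nil enorm0.
by rewrite !big_cons (le_trans (ler_enormD _ _))// lerD2l.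
Qed.

Lemma row_delta_sum u : u = \sum_(j < d) u 0 j *: delta_mx 0 j.
Proof. by rewrite {1}[u]matrix_sum_delta big_ord1. Qed.

End Norm.

Section Avg.
Context {n : nat}.

Lemma avg_row_coord d (u : 'I_n -> 'rV[R]_d) j :
  (avg u) 0 j = avgR (fun i => u i 0 j).
Proof. by rewrite !mxE summxE. Qed.

Lemma avgB (V : lmodType R) (u v : 'I_n -> V) :
  avg u - avg v = avg (fun i => u i - v i).
Proof. by rewrite /avg -scalerBr sumrB. Qed.

Lemma avgD (V : lmodType R) (u v : 'I_n -> V) :
  avg u + avg v = avg (fun i => u i + v i).
Proof. by rewrite /avg -scalerDr big_split. Qed.

Lemma avgZ (V : lmodType R) (a : R) (u : 'I_n -> V) :
  a *: avg u = avg (fun i => a *: u i).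
Proof. by rewrite /avg -scaler_sumr !scalerA mulrC. Qed.

Lemma avgR_D (u v : 'I_n -> R) : avgR u + avgR v = avgR (fun i => u i + v i).
Proof. by rewrite /avgR -mulrDr big_split. Qed.

Lemma avgR_Z (a : R) (u : 'I_n -> R) : a * avgR u = avgR (fun i => a * u i).
Proof. by rewrite /avgR mulrCA mulr_sumr. Qed.

Lemma avgR_cst (a : R) : (0 < n)%N -> avgR (fun _ : 'I_n => a) = a.
Proof.
move=> n0; rewrite /avgR sumr_const card_ord -[a *+ n]mulr_natl mulrA mulVf ?mul1r//.
by rewrite pnatr_eq0 -lt0n.
Qed.

Lemma ler_avgR (u v : 'I_n -> R) : (forall i, u i <= v i) -> avgR u <= avgR v.
Proof.
by move=> uv; rewrite ler_wpM2l ?invr_ge0// ler_sum.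
Qed.

Lemma avgR_ge0 (u : 'I_n -> R) : (forall i, 0 <= u i) -> 0 <= avgR u.
Proof. by move=> u0; rewrite mulr_ge0 ?invr_ge0// sumr_ge0. Qed.

Lemma enorm_avg d (u : 'I_n -> 'rV[R]_d) :
  enorm (avg u) <= avgR (fun i => enorm (u i)).
Proof.
by rewrite enormZ ger0_norm ?invr_ge0// ler_wpM2l ?invr_ge0// enorm_sum.
Qed.

End Avg.
End Euclidean.

(** * Normalized gradient steps *)

Section Descent.
Context {R : realType} {d : nat}.
Implicit Types (f : 'rV[R]_d -> R) (x h : 'rV[R]_d).

Lemma deriveE_grad f x h : differentiable f x -> 'D_h f x = dot (grad f x) h.
Proof.
move=> df; rewrite deriveE// {1}(row_delta_sum h) linear_sum.
apply: eq_bigr => j _; rewrite linearZ /= /grad mxE deriveE//.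
by rewrite /GRing.scale/= mulrC.
Qed.

Lemma is_derive_line f x h (s : R) : differentiable f (x + s *: h) ->
  is_derive s (1 : R) (fun s => f (x + s *: h)) (dot (grad f (x + s *: h)) h).
Proof.
move=> df; rewrite -deriveE_grad//.
have dh : derivable f (x + s *: h) h by exact: diff_derivable.
have E : (fun t : R => t^-1 *: (((fun s => f (x + s *: h)) \o shift s) (t *: 1) -
      f (x + s *: h))) =
    (fun t : R => t^-1 *: ((f \o shift (x + s *: h)) (t *: h) - f (x + s *: h))).
  apply/funext => t /=; congr (_ *: (f _ - _)).
  by rewrite [t *: 1]mulr1 scalerDl addrCA.
by split; rewrite /derivable /derive E.
Qed.

(** The mean value theorem on the segment replaces integration along it; this costs L instead of L/2
    in the quadratic term and affects only the numerical constant. *)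
Lemma smooth_upper_bound f (L : R) x h :
  (forall y, differentiable f y) -> 0 <= L -> grad_lipschitz L f ->
  f (x + h) <= f x + dot (grad f x) h + L * enorm h ^+ 2.
Proof.
move=> df L0 lip.
pose phi (s : R) := f (x + s *: h).
have dphi (s : R) : is_derive s (1 : R) phi (dot (grad f (x + s *: h)) h).
  exact: is_derive_line.
have [|s s01 E] := @MVT R phi (fun s => dot (grad f (x + s *: h)) h) 0 1 ltr01
    (fun s _ => dphi s).
  by apply: derivable_within_continuous => s _; have [] := dphi s.
move: E; rewrite /phi scale1r scale0r addr0 subr0 mulr1 => E.
have -> : f (x + h) = f x + (f (x + h) - f x) by ring.
rewrite {}E -addrA lerD2l -lerBlDl -dotBl (le_trans (dot_le _ _))//.
have := lip (x + s *: h) x; rewrite addrAC subrr add0r enormZ.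
move: s01; rewrite in_itv/= => /andP[s0 s1]; rewrite gtr0_norm// => H.
rewrite expr2 mulrA ler_wpM2r ?enorm_ge0// (le_trans H)// ler_wpM2l//.
by rewrite ler_piMl ?enorm_ge0// ltW.
Qed.

(** The decrease along g / |g| is dot (grad f x) g / |g|, which is at least |g| - |grad f x - g|,
    hence at least |grad f x| - 2 |grad f x - g|. This is the origin of the factor 2 in front of the
    estimation error. *)
Lemma normalized_descent f (L gamma : R) x g :
  (forall y, differentiable f y) -> 0 <= L -> grad_lipschitz L f -> 0 <= gamma ->
  f (x - gamma *: ((enorm g)^-1 *: g)) + gamma * enorm (grad f x)
    <= f x + 2 * gamma * enorm (grad f x - g) + L * gamma ^+ 2.
Proof.
move=> df L0 lip g0.
(* If g = 0 the point does not move, and the gradient norm is itself the estimation error. *)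
have [/enorm_eq0 ->|gn0] := eqVneq (enorm g) 0.
  rewrite !scaler0 !subr0 -addrA lerD2l.
  have := mulr_ge0 g0 (enorm_ge0 (grad f x)).
  have := mulr_ge0 L0 (sqr_ge0 gamma); lra.
have gp : 0 < enorm g by rewrite lt_neqAle eq_sym gn0 enorm_ge0.
have := smooth_upper_bound x (- (gamma *: ((enorm g)^-1 *: g))) df L0 lip.
rewrite dotNr !dotZr enormN !enormZ (ger0_norm g0) gtr0_norm ?invr_gt0//.
rewrite mulVf// mulr1 => H; rewrite -lerBrDr (le_trans H)//.
suff : gamma * enorm (grad f x) - 2 * gamma * enorm (grad f x - g)
    <= gamma * ((enorm g)^-1 * dot (grad f x) g) by lra.
have -> : dot (grad f x) g = enorm g ^+ 2 + dot (grad f x - g) g.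
  by rewrite enorm_sqr dotBl; ring.
have D : - (enorm (grad f x - g) * enorm g) <= dot (grad f x - g) g.
  by rewrite lerNl -dotNr (le_trans (dot_le _ _))// enormN.
have T := ler_enormD (grad f x - g) g; rewrite subrK in T.
have -> : gamma * enorm (grad f x) - 2 * gamma * enorm (grad f x - g) =
    gamma * (enorm (grad f x) - 2 * enorm (grad f x - g)) by ring.
rewrite ler_wpM2l// (@le_trans _ _ (enorm g - enorm (grad f x - g)))//; first lra.
rewrite -ler_pdivrMl ?invr_gt0// invrK; lra.
Qed.

(** A virtual step along the exact gradient has no estimation error and cannot go below m. *)
Lemma grad_le_gap f (L gamma m : R) x :
  (forall y, differentiable f y) -> 0 <= L -> grad_lipschitz L f -> 0 <= gamma ->
  (forall y, m <= f y) ->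
  gamma * enorm (grad f x) <= f x - m + L * gamma ^+ 2.
Proof.
move=> df L0 lip g0 fm.
have := normalized_descent x (grad f x) df L0 lip g0.
rewrite subrr enorm0 mulr0 addr0.
have := fm (x - gamma *: ((enorm (grad f x))^-1 *: grad f x)); lra.
Qed.

Lemma ler_lip_step f (L gamma : R) x g : grad_lipschitz L f -> 0 <= L -> 0 <= gamma ->
  enorm (grad f (x - gamma *: ((enorm g)^-1 *: g)) - grad f x) <= L * gamma.
Proof.
move=> lip L0 g0; apply: (le_trans (lip _ _)); rewrite ler_wpM2l//.
rewrite addrAC subrr add0r enormN !enormZ (ger0_norm g0) normfV.
rewrite (ger0_norm (enorm_ge0 g)).
by have [->|gn0] := eqVneq (enorm g) 0; rewrite ?mulr0// mulVf// mulr1.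
Qed.

Lemma differentiable_avgR n (F : 'I_n -> 'rV[R]_d -> R) x :
  (forall i, differentiable (F i) x) ->
  differentiable (fun y => avgR (F ^~ y)) x.
Proof.
move=> dF; rewrite (_ : (fun y => _) = n%:R^-1 \*: (\sum_(i < n) F i)); last first.
  by apply/funext => y; rewrite fct_sumE.
by apply: differentiableZ; apply: differentiable_sum.
Qed.

Lemma grad_avgR n (F : 'I_n -> 'rV[R]_d -> R) x :
  (forall i, differentiable (F i) x) ->
  grad (fun y => avgR (F ^~ y)) x = avg (fun i => grad (F i) x).
Proof.
move=> dF; apply/rowP => j; rewrite avg_row_coord mxE.
rewrite (_ : (fun y => _) = n%:R^-1 \*: (\sum_(i < n) F i)); last first.
  by apply/funext => y; rewrite fct_sumE.
have dv i : derivable (F i) x (delta_mx 0 j) by exact: diff_derivable.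
rewrite deriveZ; last exact: derivable_sum.
by rewrite derive_sum// /avgR; congr (_ * _); apply: eq_bigr => i _; rewrite mxE.
Qed.

End Descent.

(** * Measurability of random vectors *)

Section MeasurableRows.
Context {R : realType} {d : nat} {dS : measure_display} {S : measurableType dS}.
Implicit Types Y : S -> 'rV[R]_d.

(** Coordinatewise form, convenient for algebraic operations; [measurable_borel_rVP] identifies it
    with measurability into [borel_rV], which is used where products or preimages of Borel sets are
    formed. *)
Definition measurable_row Y : Prop :=
  forall j, measurable_fun setT (fun w => Y w 0 j).

Lemma measurable_borel_rVP Y :
  measurable_fun setT (Y : S -> borel_rV R d) <-> measurable_row Y.
Proof.
split=> [mY j _ B mB | mY].
  rewrite setTI; rewrite -[X in measurable X]setTI.
  apply: (mY measurableT ((fun v : borel_rV R d => (v : 'rV[R]_d) 0 j) @^-1` B)).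
  apply: sub_sigma_algebra; apply: sub_sigma_algebra.
  by rewrite -bigcup_seq; exists j; [exact: mem_index_enum | exists B => //; rewrite setTI].
apply: (@measurability _ _ S (borel_rV R d) setT Y
  (\big[setU/set0]_(j < d) preimage_set_system setT (fun v : 'rV[R]_d => v 0 j) measurable)).
  rewrite eqEsubset; split; last by apply: sub_smallest2r => //; exact: sub_sigma_algebra.
  apply: smallest_sub; first exact: smallest_sigma_algebra.
  by move=> A.
move=> _ [C + <-]; rewrite -bigcup_seq => -[j _ [B mB <-]].
rewrite (_ : _ `&` _ = Y @^-1` ((fun v : 'rV[R]_d => v 0 j) @^-1` B)); last by rewrite !setTI.
by rewrite -[X in measurable X]setTI; exact: (mY j measurableT _ mB).
Qed.

Lemma measurable_row_cst (v : 'rV[R]_d) : measurable_row (fun=> v).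
Proof. by move=> j; exact: measurable_cst. Qed.

Lemma measurable_rowD Y Z : measurable_row Y -> measurable_row Z ->
  measurable_row (fun w => Y w + Z w).
Proof.
move=> mY mZ j; under eq_fun do rewrite mxE.
exact: measurable_funD.
Qed.

Lemma measurable_rowZ (a : S -> R) Y : measurable_fun setT a -> measurable_row Y ->
  measurable_row (fun w => a w *: Y w).
Proof.
move=> ma mY j; under eq_fun do rewrite mxE.
exact: measurable_funM.
Qed.

Lemma measurable_rowB Y Z : measurable_row Y -> measurable_row Z ->
  measurable_row (fun w => Y w - Z w).
Proof.
move=> mY mZ j; under eq_fun do rewrite !mxE.
exact: measurable_funB.
Qed.

Lemma measurable_row_sum (I : Type) (r : seq I) (Y : I -> S -> 'rV[R]_d) :
  (forall i, measurable_row (Y i)) ->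
  measurable_row (fun w => \sum_(i <- r) Y i w).
Proof.
move=> mY j; under eq_fun do rewrite summxE.
by apply: measurable_sum => i; exact: mY.
Qed.

Lemma measurable_row_avg n (Y : 'I_n -> S -> 'rV[R]_d) :
  (forall i, measurable_row (Y i)) ->
  measurable_row (fun w => avg (fun i => Y i w)).
Proof.
move=> mY; apply: measurable_rowZ; first exact: measurable_cst.
exact: measurable_row_sum.
Qed.

Lemma measurable_enorm Y : measurable_row Y ->
  measurable_fun setT (fun w => enorm (Y w)).
Proof.
move=> mY; have msqrt : measurable_fun setT (@Num.sqrt R).
  by apply: continuous_measurable_fun; exact: sqrt_continuous.
apply: (measurableT_comp msqrt).
by apply: measurable_sum => j; exact: measurable_funX.
Qed.

End MeasurableRows.

Section Caratheodory.
Context {R : realType} {d : nat} {dS : measure_display} {S : measurableType dS}.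

Let grid (k : nat) (m : 'I_d -> int) : 'rV[R]_d := \row_j ((m j)%:~R / k.+1%:R).
Let rnd (k : nat) (v : 'rV[R]_d) (j : 'I_d) : int := Num.floor (k.+1%:R * v 0 j).

Let cvg_grid (v : 'rV[R]_d) : grid k (rnd k v) @[k --> \oo] --> v.
Proof.
apply/cvg_ballP => e e0; near=> k; split=> [|i j]; first exact: e0.
rewrite ord1 /ball/= /grid mxE /rnd.
set y := k.+1%:R * v 0 j.
have k0 : 0 < k.+1%:R :> R by [].
have -> : v 0 j = y / k.+1%:R by rewrite /y mulrAC mulfV ?mul1r// gt_eqF.
rewrite -mulrBl normrM normfV (gtr0_norm k0).
have /andP[h1 h2] := floor_itv y.
rewrite ger0_norm ?subr_ge0// (@le_lt_trans _ _ (1 / k.+1%:R))//.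
  by rewrite ler_pM2r ?invr_gt0// lerBlDr addrC; rewrite intrD in h2; exact: ltW.
rewrite div1r; near: k.
exact: near_infty_natSinv_lt (PosNum e0).
Unshelve. all: by end_near. Qed.

(* The point is rounded to a grid of mesh [1/(k+1)], where only countably many
   values of the second argument occur, and then [k] tends to infinity. *)
Lemma measurable_caratheodory (h : S -> 'rV[R]_d -> R) (Y : S -> 'rV[R]_d) :
  (forall v, measurable_fun setT (h ^~ v)) -> (forall s, continuous (h s)) ->
  measurable_row Y -> measurable_fun setT (fun s => h s (Y s)).
Proof.
move=> mh ch mY.
apply: (@measurable_fun_cvg _ _ _ setT (fun k s => h s (grid k (rnd k (Y s))))); last first.
  move=> s _; apply: (@cvg_comp _ _ _ (fun k => grid k (rnd k (Y s))) (h s)).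
    exact: cvg_grid.
  exact: ch.
move=> k _ B mB; rewrite setTI.
rewrite (_ : _ @^-1` B = \bigcup_(m : {ffun 'I_d -> int})
  ((\bigcap_(j in [set: 'I_d]) [set s | rnd k (Y s) j = m j]) `&` (h ^~ (grid k m)) @^-1` B)).
  apply: countable_bigcupT_measurable; first exact: countableP.
  move=> m; apply: measurableI; last first.
    by rewrite -[X in measurable X]setTI; exact: mh.
  apply: fin_bigcap_measurable => // j _.
  rewrite (_ : [set s | _] = (fun s => k.+1%:R * Y s 0 j) @^-1` `[(m j)%:~R, (m j + 1)%:~R[%classic).
    rewrite -[X in measurable X]setTI.
    by apply: measurable_funM => //; exact: mY.
  apply/seteqP; split => s /=; rewrite in_itv/= -floor_eq; first by move=> <-; rewrite /rnd.
  by move=> /eqP.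
apply/seteqP; split => [s /= Bs|s [m _ [/= hm]]].
  exists (finfun (rnd k (Y s))) => //; split => [j _ /=|/=]; first by rewrite ffunE.
  by rewrite (_ : finfun _ = rnd k (Y s) :> (_ -> _))//; apply/funext => j; rewrite ffunE.
by rewrite (_ : rnd k (Y s) = m :> (_ -> _))//; apply/funext => j; exact: hm.
Qed.

End Caratheodory.

(** * Independence and expectations *)

Section Freezing.
Local Open Scope ereal_scope.
Context {R : realType} {dO : measure_display} {Omega : measurableType dO}
  (P : probability Omega R).

(** Freezing: the law of the pair agrees with the product law on rectangles, hence everywhere, and
    Tonelli integrates out X with Y fixed. The function takes nonnegative extended values, so no
    integrability is asked for. *)
Lemma integral_independent d1 d2 (T1 : measurableType d1) (T2 : measurableType d2)
    (D : probability T1 R) (X : Omega -> T1) (Y : Omega -> T2) (h : T1 * T2 -> \bar R) :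
  has_law P X D -> measurable_fun setT Y ->
  (forall A B, measurable A -> measurable B ->
    P ((X @^-1` A) `&` (Y @^-1` B)) = P (X @^-1` A) * P (Y @^-1` B)) ->
  measurable_fun setT h -> (forall p, 0 <= h p) ->
  \int[P]_w h (X w, Y w) = \int[P]_w \int[D]_a h (a, Y w).
Proof.
move=> [mX lawX] mY ind mh h0.
pose Y' : {mfun Omega >-> T2} := HB.pack Y (isMeasurableFun.Build _ _ _ _ Y mY).
have mXY : measurable_fun setT (fun w => (X w, Y w)) by exact: measurable_fun_pair.
pose XY : {mfun Omega >-> (T1 * T2)%type} :=
  HB.pack (fun w => (X w, Y w)) (isMeasurableFun.Build _ _ _ _ _ mXY).
have <- : \int[distribution P XY]_p h p = \int[P]_w h (X w, Y w).
  by rewrite ge0_integral_distribution.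
rewrite (@eq_measure_integral _ _ _ _ (D \x distribution P Y')); last first.
  move=> A mA _; apply/esym/product_measure_unique => // A1 A2 mA1 mA2.
  by have := ind A1 A2 mA1 mA2; rewrite lawX.
rewrite fubini_tonelli2//.
rewrite ge0_integral_distribution//.
  exact: measurable_fun_fubini_tonelli_G.
by move=> y; exact: integral_ge0.
Qed.

End Freezing.

Section ExpectationBounds.
Local Open Scope ereal_scope.
Context {R : realType} {dO : measure_display} {Omega : measurableType dO}
  (P : probability Omega R).
Implicit Types f g : Omega -> R.

(** The integral is compared in the extended reals, so for nonnegative f this bound also contains
    integrability. *)
Definition mean_le f (a : R) : Prop := \int[P]_w (f w)%:E <= a%:E.

Lemma mean_le_cst (a : R) : mean_le (fun=> a) a.
Proof. by rewrite /mean_le integral_cst//= probability_setT mule1. Qed.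

Lemma mean_le_mono f g (a : R) :
  measurable_fun setT f -> measurable_fun setT g -> (forall w, (0 <= f w <= g w)%R) ->
  mean_le g a -> mean_le f a.
Proof.
move=> mf mg fg; apply: le_trans; apply: ge0_le_integral => //.
- by move=> w _; rewrite lee_fin; have /andP[] := fg w.
- exact/measurable_EFinP.
- exact/measurable_EFinP.
- by move=> w _; rewrite lee_fin; have /andP[] := fg w.
Qed.

Lemma mean_leD f g (a b : R) :
  measurable_fun setT f -> measurable_fun setT g ->
  (forall w, (0 <= f w)%R) -> (forall w, (0 <= g w)%R) ->
  mean_le f a -> mean_le g b -> mean_le (fun w => f w + g w)%R (a + b).
Proof.
move=> mf mg f0 g0 fa gb; rewrite /mean_le EFinD.
under eq_integral do rewrite EFinD.
rewrite ge0_integralD//; first exact: leeD.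
- by move=> w _; rewrite lee_fin.
- exact/measurable_EFinP.
- by move=> w _; rewrite lee_fin.
- exact/measurable_EFinP.
Qed.

Lemma mean_leZ f (k a : R) : measurable_fun setT f -> (forall w, (0 <= f w)%R) ->
  (0 <= k)%R -> mean_le f a -> mean_le (fun w => k * f w)%R (k * a).
Proof.
move=> mf f0 k0 fa; rewrite /mean_le EFinM.
under eq_integral do rewrite EFinM.
rewrite ge0_integralZl//; first exact: lee_wpmul2l.
- exact/measurable_EFinP.
- by move=> w _; rewrite lee_fin.
Qed.

Lemma mean_le_sum (I : Type) (r : seq I) (f : I -> Omega -> R) (a : I -> R) :
  (forall i, measurable_fun setT (f i)) -> (forall i w, (0 <= f i w)%R) ->
  (forall i, mean_le (f i) (a i)) ->
  mean_le (fun w => \sum_(i <- r) f i w)%R (\sum_(i <- r) a i)%R.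
Proof.
move=> mf f0 fa; elim: r => [|i r IH].
  by under [X in mean_le X]eq_fun do rewrite big_nil; rewrite big_nil; exact: mean_le_cst.
under [X in mean_le X]eq_fun do rewrite big_cons.
rewrite big_cons; apply: mean_leD => //; first exact: measurable_sum.
by move=> w; exact: sumr_ge0.
Qed.

(** Jensen's inequality through a tangent line: f <= f^2 / (2 s) + s / 2 for every s > 0. The choice
    s = b + e stays positive when b = 0, and e is arbitrary. *)
Lemma mean_le_of_sq f (b : R) : (0 <= b)%R ->
  measurable_fun setT f -> (forall w, (0 <= f w)%R) ->
  mean_le (fun w => f w ^+ 2)%R (b ^+ 2) -> mean_le f b.
Proof.
move=> b0 mf f0 hf; apply/lee_addgt0Pr => e e0.
pose s := (b + e)%R; have s0 : (0 < s)%R by rewrite ltr_wpDl.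
have c0 : (0 <= (2 * s)^-1)%R by rewrite invr_ge0 mulr_ge0// ltW.
have mf2 : measurable_fun setT (fun w => (f w ^+ 2)%R) by exact: measurable_funX.
have : mean_le f ((2 * s)^-1 * b ^+ 2 + s / 2).
  apply: (@mean_le_mono _ (fun w => (2 * s)^-1 * f w ^+ 2 + s / 2)%R) => //.
  - by apply: measurable_funD => //; exact: measurable_funM.
  - move=> w; rewrite f0/=.
    have -> : ((2 * s)^-1 * f w ^+ 2 + s / 2 = f w + (2 * s)^-1 * (f w - s) ^+ 2)%R.
      by field; rewrite gt_eqF.
    by rewrite lerDl mulr_ge0 ?sqr_ge0.
  - apply: mean_leD => //.
    + exact: measurable_funM.
    + by move=> w; rewrite mulr_ge0 ?sqr_ge0.
    + by move=> w; rewrite divr_ge0// ltW.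
    + by apply: mean_leZ => // w; exact: sqr_ge0.
    + exact: mean_le_cst.
move/le_trans; apply; rewrite -EFinD lee_fin -/s.
have bs : (b ^+ 2 <= s ^+ 2)%R by rewrite ler_pXn2r ?nnegrE ?lerDl ?(ltW e0) ?(ltW s0).
have := ler_wpM2l c0 bs.
have -> : ((2 * s)^-1 * s ^+ 2 = s / 2)%R by field; rewrite gt_eqF.
lra.
Qed.

End ExpectationBounds.

Section SubSigmaAlgebra.
Context {dO : measure_display} {Omega : measurableType dO}.
Implicit Types H : set (set Omega).

Lemma sigma_sub_measurable H : H `<=` measurable -> <<s H >> `<=` measurable.
Proof. exact: smallest_sub (@sigma_algebra_measurable _ Omega). Qed.

Lemma measurable_fun_sub_sigma H H' dT (T : measurableType dT) (f : Omega -> T) :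
  H `<=` <<s H' >> ->
  measurable_fun setT (f : g_sigma_algebraType H -> T) ->
  measurable_fun setT (f : g_sigma_algebraType H' -> T).
Proof.
move=> HH' mf _ B mB; have := mf measurableT B mB.
by apply: smallest_sub => //; exact: smallest_sigma_algebra.
Qed.

Lemma measurable_fun_ambient H dT (T : measurableType dT) (f : Omega -> T) :
  H `<=` measurable ->
  measurable_fun setT (f : g_sigma_algebraType H -> T) -> measurable_fun setT f.
Proof.
move=> HO mf _ B mB; apply: (sigma_sub_measurable HO).
exact: (mf measurableT B mB).
Qed.

Lemma measurable_fun_sigma_of H dT (T : measurableType dT) (f : Omega -> T) :
  sigma_of f `<=` <<s H >> ->
  measurable_fun setT (f : g_sigma_algebraType H -> T).
Proof. by move=> fH _ B mB; apply: fH; exists B. Qed.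

End SubSigmaAlgebra.

Section Independence.
Local Open Scope ereal_scope.
Context {R : realType} {dO : measure_display} {Omega : measurableType dO}
  (P : probability Omega R).

(** The two finite measures B -> P (E and B) and B -> P E * P B agree on a class stable under
    intersection that contains the whole space, hence on the sigma-algebra it generates. *)
Lemma independent_generated (E : set Omega) (G : set (set Omega)) :
  measurable E -> G `<=` measurable -> setI_closed G -> G setT ->
  (forall B, G B -> P (E `&` B) = P E * P B) ->
  forall B, <<s G >> B -> P (E `&` B) = P E * P B.
Proof.
move=> mE Gm GI GT ind B GB.
have PE : P E \is a fin_num by exact: fin_num_measure.
have PE0 : (0 <= fine (P E))%R by rewrite fine_ge0.
have := @g_sigma_algebra_measure_unique _ R Omega G Gm (fun=> setT) (fun=> GT)
  (bigcup_const _ _) (mrestr P mE) (mscale (NngNum PE0) P) GI.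
rewrite /mrestr/= /mscale/= fineK// => /(_ _ _ _ B GB); rewrite setIC; apply.
- by exists 0%N.
- by move=> C GC; rewrite /mrestr/= setIC ind.
- by move=> _; rewrite /mrestr setTI -ge0_fin_numE.
Qed.

Section Family.
Context {n : nat} {dT : 'I_n -> measure_display} {T : forall i, measurableType (dT i)}
  (X : forall i, Omega -> T i) (G : set (set Omega)).

(** An intersection-stable class that, for a sigma-algebra G, generates the information in G and in
    the first k variables; leaving the other coordinates free is encoded by A i = setT. *)
Definition family_events (k : nat) : set (set Omega) :=
  [set C | exists (A : forall i, set (T i)) (B : set Omega),
     [/\ forall i, measurable (A i), forall i : 'I_n, (k <= i)%N -> A i = setT, G B &
         C = (\bigcap_(i in [set: 'I_n]) (X i @^-1` A i)) `&` B]].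

Context (GT : G setT).
Context (GI : setI_closed G).
Context (Gm : G `<=` measurable).
Context (mX : forall i, measurable_fun setT (X i)).

Lemma family_eventsT k : family_events k setT.
Proof.
exists (fun=> setT), setT; split=> //.
by rewrite setIT; apply/seteqP; split.
Qed.

Lemma family_events_sub k : family_events k `<=` measurable.
Proof.
move=> _ [A [B [mA _ GB ->]]]; apply: measurableI; last exact: Gm.
apply: fin_bigcap_measurable => // i _.
by rewrite -[X in measurable X]setTI; exact: mX.
Qed.

Lemma family_events_setI k : setI_closed (family_events k).
Proof.
move=> _ _ [A [B [mA AT GB ->]]] [A' [B' [mA' AT' GB' ->]]].
exists (fun i => A i `&` A' i), (B `&` B'); split.
- by move=> i; exact: measurableI.
- by move=> i ki; rewrite AT// AT'// setIT.
- exact: GI.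
- by rewrite setIACA -bigcapI.
Qed.

Lemma sub_family_events k : G `<=` family_events k.
Proof.
move=> B GB; exists (fun=> setT), B; split=> //.
by apply/seteqP; split => [w Bw|w []].
Qed.

Lemma sigma_of_family_events (i : 'I_n) k : (i < k)%N ->
  sigma_of (X i) `<=` family_events k.
Proof.
move=> ik _ [A mA <-].
exists (dfwith (fun j => [set: T j]) i A), setT; split=> //.
- by move=> j; case: dfwithP.
- by move=> j kj; rewrite dfwithout// neq_ltn (leq_trans ik kj).
- rewrite setTI setIT; apply/seteqP; split => [w Aw j _|w /(_ i I)].
    by case: dfwithP.
  by rewrite /= dfwithin.
Qed.

(** An event of the class is free at coordinate k, so A0 can be inserted there. The product formula
    then holds with and without A0, and the two products differ only in their k-th factor. *)
Lemma independent_family_events (k : 'I_n) : independent_family P X G ->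
  forall A B, measurable A -> <<s family_events k >> B ->
  P ((X k @^-1` A) `&` B) = P (X k @^-1` A) * P B.
Proof.
move=> ind A0 B0 mA0; apply: independent_generated.
- by rewrite -[X in measurable X]setTI; exact: mX.
- exact: family_events_sub.
- exact: family_events_setI.
- exact: family_eventsT.
move=> _ [A [B [mA AT GB ->]]].
have mA' i : measurable (dfwith A k A0 i) by case: dfwithP.
have -> : (X k @^-1` A0) `&` ((\bigcap_(i in [set: 'I_n]) (X i @^-1` A i)) `&` B) =
    (\bigcap_(i in [set: 'I_n]) (X i @^-1` dfwith A k A0 i)) `&` B.
  rewrite setIA; congr (_ `&` _); apply/seteqP; split => [w [A0w Aw] j _|w Aw].
    by case: dfwithP => // i _; exact: Aw.
  split; first by have := Aw k I; rewrite /= dfwithin.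
  move=> j _; have [<-|kj] := eqVneq k j; first by rewrite AT.
  by have := Aw j I; rewrite /= dfwithout.
rewrite ind// ind// (bigD1 k)//= [in RHS](bigD1 k)//= dfwithin AT//.
rewrite preimage_setT probability_setT mul1e muleA; congr (_ * _ * _).
by apply: eq_bigr => i ik; rewrite dfwithout// eq_sym.
Qed.

End Family.
End Independence.

(** * Stochastic gradient oracles *)

Section CenteredNoise.
Context {R : realType} {d : nat} {dT : measure_display} {T : measurableType dT}
  (D : probability T R) (N : T -> 'rV[R]_d).

(** The cross term of the expanded square is linear in the coordinates of N, so it integrates to
    zero. The remaining part [q] is integrable by the second-moment bound, which allows the integral
    to be split. *)
Lemma mean_sq_add_centered (s : 'rV[R]_d) (c b : R) :
  (forall j, D.-integrable setT (fun a => (N a 0 j)%:E)) ->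
  (forall j : 'I_d, \int[D]_a (N a (0%R : 'I_1) j)%:E = 0)%E ->
  mean_le D (fun a => enorm (N a) ^+ 2) b ->
  mean_le D (fun a => enorm (s + c *: N a) ^+ 2) (enorm s ^+ 2 + c ^+ 2 * b).
Proof.
move=> iN N0 Nb.
have mN : measurable_row N.
  by move=> j; apply/measurable_EFinP; have /integrableP[] := iN j.
have mN2 : measurable_fun setT (fun a => enorm (N a) ^+ 2).
  by apply: measurable_funX; exact: measurable_enorm.
pose q a := (enorm s ^+ 2 + c ^+ 2 * enorm (N a) ^+ 2).
have q0 a : 0 <= q a by rewrite /q addr_ge0 ?sqr_ge0// mulr_ge0 ?sqr_ge0.
have mq : measurable_fun setT q by apply: measurable_funD => //; exact: measurable_funM.
have qb : mean_le D q (enorm s ^+ 2 + c ^+ 2 * b).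
  apply: mean_leD => //.
  - exact: measurable_funM.
  - by move=> a; exact: sqr_ge0.
  - by move=> a; rewrite mulr_ge0 ?sqr_ge0.
  - exact: mean_le_cst.
  - by apply: mean_leZ => // [a|]; exact: sqr_ge0.
have iq : D.-integrable setT (EFin \o q).
  apply/integrableP; split; first exact/measurable_EFinP.
  under eq_integral do rewrite /= ger0_norm//.
  by apply: le_lt_trans qb _; rewrite ltry.
pose f j a := ((2 * c * s 0 j)%:E * (N a 0 j)%:E)%E.
have if_ j : D.-integrable setT (f j) by exact: integrableZl.
rewrite /mean_le.
have -> : (\int[D]_a (enorm (s + c *: N a) ^+ 2)%:E)%E =
    (\int[D]_a ((EFin \o q) a + \sum_(j < d) f j a))%E.
  apply: eq_integral => a _; rewrite /= /f.
  under eq_bigr do rewrite -EFinM.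
  rewrite sumEFin -EFinD; congr _%:E.
  rewrite enorm_sqrD enormZ exprMn -normrX ger0_norm ?sqr_ge0//.
  rewrite dotZr /dot /q !mulr_sumr addrAC; congr (_ + _).
  by apply: eq_bigr => j _; rewrite !mulrA.
rewrite integralD//; last exact: integrable_sum.
rewrite integral_sum// big1 ?adde0// => j _.
by rewrite integralZl// N0 mule0.
Qed.

End CenteredNoise.

Section Oracle.
Context {R : realType} {d : nat} {dO : measure_display} {Omega : measurableType dO}
  (P : probability Omega R).
Context {dT : measure_display} {T : measurableType dT} (D : probability T R).
Context (Phi : T -> 'rV[R]_d -> 'rV[R]_d) (phi : 'rV[R]_d -> 'rV[R]_d) (sigma : R).
Context (cPhi : forall a, continuous (Phi a)).
Context (cphi : continuous phi).
Context (Phi_mean : forall x, has_mean D (Phi ^~ x) (phi x)).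
Context (Phi_var : forall x,
  mean_le D (fun a => enorm (Phi a x - phi x) ^+ 2) (sigma ^+ 2)).

Let mPhi x : measurable_row (Phi ^~ x).
Proof.
by move=> j; apply/measurable_EFinP; have [/integrableP[]] := Phi_mean x 0 j.
Qed.

Lemma measurable_oracle dS (S : measurableType dS) (X : S -> T) (x : S -> 'rV[R]_d) :
  measurable_fun setT X -> measurable_row x ->
  measurable_row (fun w => Phi (X w) (x w)).
Proof.
move=> mX mx j.
apply: (@measurable_caratheodory _ _ _ _ (fun s v => Phi (X s) v 0 j)) => // [v|s v].
  exact: (measurableT_comp (mPhi v j) mX).
exact: (continuous_comp (@cPhi (X s) v) (@coord_continuous _ _ _ 0 j _)).
Qed.

Lemma measurable_continuous_row dS (S : measurableType dS) (x : S -> 'rV[R]_d) :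
  measurable_row x -> measurable_row (fun w => phi (x w)).
Proof.
move=> mx j.
apply: (@measurable_caratheodory _ _ _ _ (fun s v => phi v 0 j)) => // s v.
exact: (continuous_comp (@cphi v) (@coord_continuous _ _ _ 0 j _)).
Qed.

Lemma measurable_noise dS (S : measurableType dS) (X : S -> T) (x : S -> 'rV[R]_d) :
  measurable_fun setT X -> measurable_row x -> measurable_row (fun w => Phi (X w) (x w) - phi (x w)).
Proof.
move=> mX mx; apply: measurable_rowB; first exact: measurable_oracle.
exact: measurable_continuous_row.
Qed.

Context (G : set (set Omega)) (X : Omega -> T).
Context (GO : G `<=` measurable).
Context (lawX : has_law P X D).
Context (indX : forall A B, measurable A -> <<s G >> B ->
  (P ((X @^-1` A) `&` B) = P (X @^-1` A) * P B)%E).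

Let mphi0 (x : 'rV[R]_d) j :
  D.-integrable setT (fun a => ((Phi a x - phi x) 0 j)%:E) /\
  (\int[D]_a ((Phi a x - phi x)%R (0%R : 'I_1) j)%:E = 0)%E.
Proof.
have [iP eP] := Phi_mean x 0 j.
have ic := finite_measure_integrable_cst D (phi x 0 j) (@measurableT _ T).
have E : (fun a => ((Phi a x - phi x) 0 j)%:E) =
    ((fun a => (Phi a x (0%R : 'I_1) j)%:E) \- (EFin \o cst (phi x (0%R : 'I_1) j)))%E.
  by apply/funext => a /=; rewrite !mxE.
rewrite E; split; first exact: integrableB.
rewrite integralB//; move: eP; rewrite unlock => ->.
rewrite [X in (_ - X)%E](_ : _ = (phi x 0 j)%:E) ?subee//.
transitivity (\int[D]_a (cst (phi x 0 j)%:E) a)%E; first by [].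
by rewrite integral_cst//= probability_setT mule1.
Qed.

Lemma mean_sq_add_noise (A x : Omega -> 'rV[R]_d) (c a : R) :
  measurable_row (A : g_sigma_algebraType G -> _) ->
  measurable_row (x : g_sigma_algebraType G -> _) ->
  mean_le P (fun w => enorm (A w) ^+ 2) a ->
  mean_le P (fun w => enorm (A w + c *: (Phi (X w) (x w) - phi (x w))) ^+ 2)
    (a + c ^+ 2 * sigma ^+ 2).
Proof.
move=> mA mx Aa.
(* The identity, seen as a map to the same space with the sigma-algebra generated by G, serves as
   the second variable of the freezing lemma: the whole past is frozen at once, and with it both A
   and x. *)
have mY : measurable_fun setT (id : Omega -> g_sigma_algebraType G).
  by move=> _ B GB; rewrite setTI; exact: (sigma_sub_measurable GO).
have mA' : measurable_row A by move=> j; exact: (measurable_fun_ambient GO (mA j)).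
pose h (p : T * g_sigma_algebraType G) : \bar R :=
  (enorm (A p.2 + c *: (Phi p.1 (x p.2) - phi (x p.2))) ^+ 2)%:E.
have mA2 : measurable_row (fun p : T * g_sigma_algebraType G => A p.2).
  by move=> j; exact: (measurableT_comp (mA j) measurable_snd).
have mx2 : measurable_row (fun p : T * g_sigma_algebraType G => x p.2).
  by move=> j; exact: (measurableT_comp (mx j) measurable_snd).
have mh : measurable_fun setT h.
  apply/measurable_EFinP; apply: measurable_funX; apply: measurable_enorm.
  apply: measurable_rowD => //; apply: measurable_rowZ; first exact: measurable_cst.
  exact: measurable_noise.
rewrite /mean_le.
have -> : (\int[P]_w (enorm (A w + c *: (Phi (X w) (x w) - phi (x w))) ^+ 2)%:E =
    \int[P]_w h (X w, w))%E by [].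
rewrite (@integral_independent _ _ _ _ _ _ T (g_sigma_algebraType G) D X id h)//; last first.
  by move=> p; rewrite lee_fin sqr_ge0.
apply: (@le_trans _ _ (\int[P]_w (enorm (A w) ^+ 2 + c ^+ 2 * sigma ^+ 2)%:E)%E).
  apply: ge0_le_integral => //.
  - by move=> w _; apply: integral_ge0 => b _; rewrite lee_fin sqr_ge0.
  - apply: (measurableT_comp (measurable_fun_fubini_tonelli_G (m1 := D) h mh _)) => //.
    by move=> p; rewrite lee_fin sqr_ge0.
  - apply/measurable_EFinP; apply: measurable_funD => //; apply: measurable_funX.
    exact: measurable_enorm.
  - move=> w _; rewrite /h/=; apply: mean_sq_add_centered => [j|j|].
    + by have [] := mphi0 (x w) j.
    + by have [] := mphi0 (x w) j.
    + exact: Phi_var.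
apply: (@mean_leD _ _ _ P) => //.
- by apply: measurable_funX; exact: measurable_enorm.
- by move=> w; exact: sqr_ge0.
- by move=> w; rewrite mulr_ge0 ?sqr_ge0.
- exact: mean_le_cst.
Qed.

Lemma mean_noise (x : Omega -> 'rV[R]_d) : (0 <= sigma) ->
  measurable_row (x : g_sigma_algebraType G -> _) ->
  mean_le P (fun w => enorm (Phi (X w) (x w) - phi (x w))) sigma.
Proof.
move=> s0 mx; have mx' : measurable_row x.
  by move=> j; exact: (measurable_fun_ambient GO (mx j)).
apply: mean_le_of_sq => //.
- by apply: measurable_enorm; apply: measurable_noise => //; case: lawX.
- by move=> w; exact: enorm_ge0.
have := @mean_sq_add_noise (fun=> 0) x 1 0 (measurable_row_cst _) mx.
rewrite add0r expr1n mul1r; under [X in mean_le _ X]eq_fun do rewrite enorm0 expr0n/=.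
move=> /(_ (mean_le_cst _ _)).
by under [X in mean_le _ X]eq_fun do rewrite add0r scale1r.
Qed.

End Oracle.

Section AveragedOracle.
Context {R : realType} {d n : nat} {dO : measure_display} {Omega : measurableType dO}
  (P : probability Omega R).
Context {dT : 'I_n -> measure_display} {T : forall i, measurableType (dT i)}
  (D : forall i, probability (T i) R).
Context (Phi : forall i, T i -> 'rV[R]_d -> 'rV[R]_d) (phi : 'I_n -> 'rV[R]_d -> 'rV[R]_d)
  (sigma : R).
Context (cPhi : forall i a, continuous (@Phi i a)).
Context (cphi : forall i, continuous (phi i)).
Context (Phi_mean : forall i x, has_mean (D i) (@Phi i ^~ x) (phi i x)).
Context (Phi_var : forall i x,
  mean_le (D i) (fun a => enorm (@Phi i a x - phi i x) ^+ 2) (sigma ^+ 2)).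
Context (G : set (set Omega)) (X : forall i, Omega -> T i).
Context (GO : G `<=` measurable).
Context (lawX : forall i, has_law P (X i) (D i)).
Context (indX : independent_family P X <<s G >>).

Let Gk k := family_events X <<s G >> k.

Let sGO : <<s G >> `<=` measurable.
Proof. exact: sigma_sub_measurable. Qed.

Let sGT : <<s G >> setT.
Proof. exact: (@measurableT _ (g_sigma_algebraType G)). Qed.

Let sGI : setI_closed <<s G >>.
Proof. by move=> A B; exact: (@measurableI _ (g_sigma_algebraType G)). Qed.

Let mX i : measurable_fun setT (X i).
Proof. by case: (lawX i). Qed.

Let sub_Gk k dS (S : measurableType dS) (f : Omega -> S) :
  measurable_fun setT (f : g_sigma_algebraType G -> S) ->
  measurable_fun setT (f : g_sigma_algebraType (Gk k) -> S).
Proof.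
apply: measurable_fun_sub_sigma => A GA; apply: sub_sigma_algebra.
by apply: sub_family_events; exact: sub_sigma_algebra.
Qed.

(* The samples are revealed one client at a time, so that the increments are
   centered given the past and the cross terms vanish. *)
Lemma mean_sq_add_noises (A x : Omega -> 'rV[R]_d) (c a : R) :
  measurable_row (A : g_sigma_algebraType G -> _) ->
  measurable_row (x : g_sigma_algebraType G -> _) ->
  mean_le P (fun w => enorm (A w) ^+ 2) a ->
  mean_le P (fun w => enorm (A w + c *: \sum_(i < n) (@Phi i (X i w) (x w) - phi i (x w))) ^+ 2)
    (a + n%:R * (c ^+ 2 * sigma ^+ 2)).
Proof.
move=> mA mx Aa.
pose N (i : 'I_n) w := @Phi i (X i w) (x w) - phi i (x w).
pose S k w := A w + c *: \sum_(i < n | (i < k)%N) N i w.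
have mS k : measurable_row (S k : g_sigma_algebraType (Gk k) -> _).
  apply: measurable_rowD; first by move=> j; exact: (sub_Gk (mA j)).
  apply: measurable_rowZ; first exact: measurable_cst.
  under eq_fun do rewrite big_mkcond.
  apply: measurable_row_sum => i; have [ik|_] := ltnP i k; last exact: measurable_row_cst.
  apply: (@measurable_noise _ _ _ _ (D i)) => //.
  - apply: measurable_fun_sigma_of => B XB; apply: sub_sigma_algebra.
    exact: (sigma_of_family_events sGT ik XB).
  - by move=> j; exact: (sub_Gk (mx j)).
have key k : (k <= n)%N ->
    mean_le P (fun w => enorm (S k w) ^+ 2) (a + k%:R * (c ^+ 2 * sigma ^+ 2)).
  elim: k => [_|k IH kn].
    rewrite mul0r addr0; under [X in mean_le _ X]eq_fun do rewrite /S big_pred0 ?scaler0 ?addr0//.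
    exact: Aa.
  pose i0 := Ordinal kn.
  have ES w : S k.+1 w = S k w + c *: N i0 w.
    rewrite /S -addrA -scalerDr; congr (_ + _ *: _).
    rewrite (bigD1 i0) ?ltnSn//= addrC; congr (_ + _).
    apply: eq_bigl => i; rewrite ltnS (leq_eqVlt i).
    by rewrite -val_eqE/=; case: (ltngtP i k) => //=.
  under [X in mean_le _ X]eq_fun do rewrite ES.
  rewrite -natr1 mulrDl mul1r addrA.
  (* The sample of client k is independent of [Gk k], for which the partial sum [S k] and the point
     are measurable. *)
  apply: (@mean_sq_add_noise _ _ _ _ P _ _ (D i0) _ _ _ _ _ _ _ (Gk k)) => //.
  - exact: family_events_sub.
  - move=> A' B mA' GB; exact: (independent_family_events sGT sGI sGO mX (k := i0) indX mA' GB).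
  - by move=> j; exact: (sub_Gk (mx j)).
  - exact: (IH (ltnW kn)).
have := key n (leqnn n); rewrite /S.
by under [X in mean_le _ X]eq_fun do under eq_bigl do rewrite ltn_ord.
Qed.

End AveragedOracle.

(** * Step sizes *)

Section Schedules.
Context {R : realType}.
Implicit Types (t T : nat).

(** All real exponents of the schedules are multiples of 1/4; through this root they become natural
    powers, within reach of [ring] and [field]. *)
Definition sched_root (t : nat) : R := (2 / t.+2%:R) `^ (1 / 4).

Lemma sched_root_gt0 t : 0 < sched_root t.
Proof. by rewrite powR_gt0// divr_gt0. Qed.

Lemma sched_root_le1 t : sched_root t <= 1.
Proof.
have one : 1 = 1 `^ (1 / 4) :> R by rewrite powR1.
rewrite [leRHS]one ge0_ler_powR ?nnegrE ?divr_ge0//.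
by rewrite ler_pdivrMr// mul1r ler_nat.
Qed.

Lemma sched_rootX t k : sched_root t ^+ k = (2 / t.+2%:R) `^ (k%:R / 4).
Proof. by rewrite -powR_mulrn ?powR_ge0// -powRrM mulrAC -mulrA mul1r mulrC. Qed.

Lemma sched_root4 t : sched_root t ^+ 4 = 2 / t.+2%:R.
Proof. by rewrite sched_rootX mulfV ?pnatr_eq0// powRr1// divr_ge0. Qed.

Lemma eta_schedE t : eta_sched R t = sched_root t ^+ 2.
Proof. by rewrite sched_rootX; congr (_ `^ _); field. Qed.

Lemma gamma_schedE (gamma0 : R) t : gamma_sched gamma0 t = gamma0 * sched_root t ^+ 3.
Proof. by rewrite sched_rootX. Qed.

Lemma sched_root0 : sched_root 0 = 1.
Proof. by rewrite /sched_root mulfV ?pnatr_eq0// powR1. Qed.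

Lemma sched_root_homo : {homo sched_root : s t / (s <= t)%N >-> t <= s}.
Proof.
move=> s t st; rewrite ge0_ler_powR ?nnegrE ?divr_ge0// ler_pM2l//.
by rewrite lef_pV2 ?posrE// ler_nat.
Qed.

Lemma eta_sched0 : eta_sched R 0 = 1.
Proof. by rewrite eta_schedE sched_root0 expr1n. Qed.

Lemma eta_sched_gt0 t : 0 < eta_sched R t.
Proof. by rewrite eta_schedE exprn_gt0// sched_root_gt0. Qed.

Lemma eta_sched_le1 t : eta_sched R t <= 1.
Proof. by rewrite eta_schedE exprn_ile1// ?sched_root_le1// ltW// sched_root_gt0. Qed.

(** Here eta_1 = sqrt (2/3). The bound gives 2 eta_1 >= 1, the base case of the momentum
    estimate. *)
Lemma eta_sched1_ge : 1 / 2 <= eta_sched R 1.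
Proof.
rewrite -(@ler_pXn2r _ 2)// ?nnegrE ?divr_ge0 ?(ltW (eta_sched_gt0 _))//.
by rewrite eta_schedE -exprM sched_root4; lra.
Qed.

(** With m = t + 2 and eta_t^2 = 2/m, squaring reduces the claim to (m - 1)^2 (m + 1) <= m^3. It
    says that the schedule decays slowly enough for a multiple of [eta_t] to dominate the momentum
    error. *)
Lemma eta_sched_decr t :
  eta_sched R t * (1 - eta_sched R t ^+ 2 / 2) <= eta_sched R t.+1.
Proof.
have e4 s : eta_sched R s ^+ 2 = 2 / s.+2%:R by rewrite eta_schedE -exprM sched_root4.
rewrite e4; set m : R := t.+2%:R; have m0 : 0 < m by rewrite ltr0n.
have m1 : 1 <= m by rewrite ler1n.
have -> : 1 - 2 / m / 2 = (m - 1) / m by field; rewrite gt_eqF.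
rewrite -(@ler_pXn2r _ 2)// ?nnegrE ?mulr_ge0 ?(ltW (eta_sched_gt0 _)) ?subr_ge0 ?invr_ge0 ?(ltW m0)//.
rewrite exprMn !e4 -/m -(natr1 t.+2) -/m.
rewrite ler_pdivlMr; last by rewrite addr_gt0.
have -> : 2 / m * ((m - 1) / m) ^+ 2 * (m + 1) = 2 - 2 * (m ^+ 2 + m - 1) / m ^+ 3.
  by field; rewrite gt_eqF.
rewrite gerBl divr_ge0 ?exprn_ge0 ?(ltW m0)// mulr_ge0//.
have := sqr_ge0 m; lra.
Qed.

Lemma gamma_sched_gt0 (gamma0 : R) t : 0 < gamma0 -> 0 < gamma_sched gamma0 t.
Proof. by move=> g0; rewrite gamma_schedE mulr_gt0// exprn_gt0// sched_root_gt0. Qed.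

Lemma gamma_sched_homo (gamma0 : R) : 0 < gamma0 ->
  {homo gamma_sched gamma0 : s t / (s <= t)%N >-> t <= s}.
Proof.
move=> g0 s t st; rewrite !gamma_schedE ler_pM2l// ler_pXn2r// ?nnegrE ?(ltW (sched_root_gt0 _))//.
exact: sched_root_homo.
Qed.

Lemma gamma_sched0 (gamma0 : R) : gamma_sched gamma0 0 = gamma0.
Proof. by rewrite gamma_schedE sched_root0 expr1n mulr1. Qed.

Lemma gamma_sched_sqr (gamma0 : R) t :
  gamma_sched gamma0 t ^+ 2 = gamma0 ^+ 2 * eta_sched R t ^+ 3.
Proof. by rewrite gamma_schedE eta_schedE; ring. Qed.

Lemma gamma_sched_le_eta (gamma0 : R) t : 0 < gamma0 ->
  gamma_sched gamma0 t <= gamma0 * eta_sched R t.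
Proof.
move=> g0; rewrite gamma_schedE eta_schedE ler_pM2l// ler_wiXn2l//.
  by rewrite ltW// sched_root_gt0.
exact: sched_root_le1.
Qed.

Lemma gamma_sched_le (gamma0 : R) t : 0 < gamma0 -> gamma_sched gamma0 t <= gamma0.
Proof. by move=> g0; rewrite -[leRHS]gamma_sched0 gamma_sched_homo. Qed.

Lemma gamma_sched_sqr_le (gamma0 : R) t :
  gamma_sched gamma0 t ^+ 2 <= gamma0 ^+ 2 * (2 / t.+2%:R).
Proof.
rewrite -sched_root4 gamma_schedE exprMn ler_wpM2l ?sqr_ge0// -exprM.
by rewrite ler_wiXn2l ?sched_root_le1// ltW// sched_root_gt0.
Qed.

Lemma gamma_eta_sched_le (gamma0 : R) t : 0 < gamma0 ->
  gamma_sched gamma0 t * eta_sched R t <= gamma0 * (2 / t.+2%:R).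
Proof.
move=> g0; rewrite -sched_root4 gamma_schedE eta_schedE -mulrA ler_pM2l// -exprD.
by rewrite ler_wiXn2l ?sched_root_le1// ltW// sched_root_gt0.
Qed.

Lemma sum_harmonic_le T : (1 <= T)%N ->
  \sum_(1 <= t < T) (2 / t.+2%:R : R) <= 2 * ln (T%:R + 1).
Proof.
case: T => // T _; elim: T => [|T IH].
  by rewrite big_geq// mulr_ge0// ln_ge0// lerDr.
rewrite big_nat_recr//=; apply: (le_trans (lerD IH (lexx _))).
rewrite -lerBrDl -mulrBr ler_pM2l// natr1 natr1.
set m : R := T.+3%:R; have m0 : 0 < m by rewrite ltr0n.
have m1 : 1 < m by rewrite ltr1n.
have -> : T.+2%:R = m * (1 + - m^-1).
  by rewrite mulrDr mulrN mulfV ?gt_eqF// mulr1 /m -(natr1 T.+2); ring.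
have i0 : 0 < 1 + - m^-1 by rewrite subr_gt0 invf_lt1.
rewrite lnM ?posrE// opprD addrA subrr add0r.
(* The inequality ln (1 - 1/m) <= - 1/m makes each harmonic term at most an increment of the
   logarithm. *)
have := @le_ln1Dx R (- m^-1); rewrite ltrN2 invf_lt1// => /(_ m1).
by rewrite lerNr.
Qed.

(** Each of the T terms is at least the last one, gamma0 (2 / (T + 1))^(3/4), and 2 / (T + 1) >= 1 /
    T. *)
Lemma sum_gamma_sched_ge (gamma0 : R) T : 0 < gamma0 -> (1 <= T)%N ->
  gamma0 * T%:R `^ (1 / 4) <= \sum_(t < T) gamma_sched gamma0 t.
Proof.
move=> g0; case: T => // T _.
apply: (@le_trans _ _ (\sum_(t < T.+1) gamma_sched gamma0 T)); last first.
  by apply: ler_sum => t _; apply: gamma_sched_homo => //; rewrite -ltnS.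
rewrite sumr_const card_ord /gamma_sched -mulrnAr ler_pM2l//.
set m : R := T.+1%:R; have m0 : 0 < m by rewrite ltr0n.
rewrite -[leRHS]mulr_natl -/m.
have -> : m `^ (1 / 4) = m * m^-1 `^ (3 / 4).
  rewrite -[m^-1](powR_inv1 (ltW m0)) -powRrM -[X in _ = X * _](powRr1 (ltW m0)) -powRD.
    by congr (_ `^ _); field.
  by rewrite (gt_eqF m0) implybT.
rewrite ler_pM2l// ge0_ler_powR ?nnegrE ?divr_ge0 ?invr_ge0 ?(ltW m0)//.
rewrite ler_pdivlMr// mulrC ler_pdivrMr// /m -natrM ler_nat.
by rewrite mul2n -addnn addnS ltnS leq_addr.
Qed.

(* Stated for the second moment [2 eta K] of the momentum error, where
   [K = s + L^2 gamma0^2]. *)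
Lemma momentum_sq_step (eta eta' gsq s l : R) : 0 < eta -> eta <= 1 ->
  eta * (1 - eta ^+ 2 / 2) <= eta' -> 0 <= s -> 0 <= l -> gsq = eta ^+ 3 * l ->
  (1 - eta) ^+ 2 * ((1 + eta) * (2 * eta * (s + l)) + (1 + eta^-1) * gsq) + eta ^+ 2 * s
    <= 2 * eta' * (s + l).
Proof.
move=> e0 e1 ee' s0 l0 ->.
have -> : (1 + eta^-1) * (eta ^+ 3 * l) = eta ^+ 2 * (1 + eta) * l.
  by field; rewrite gt_eqF.
have K0 : 0 <= s + l by rewrite addr_ge0.
apply: (@le_trans _ _ (2 * (eta * (1 - eta ^+ 2 / 2)) * (s + l))); last first.
  by rewrite ler_wpM2r// ler_pM2l.
(* The slack is eta^2 times a combination of s and l with coefficients (1 - eta)(1 + 2 eta) and 1 +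
   2 eta - eta^2 - eta^3, both nonnegative on (0,1]. *)
have -> : (1 - eta) ^+ 2 * ((1 + eta) * (2 * eta * (s + l)) + eta ^+ 2 * (1 + eta) * l)
    + eta ^+ 2 * s = 2 * (eta * (1 - eta ^+ 2 / 2)) * (s + l)
    - eta ^+ 2 * ((1 + eta - 2 * eta ^+ 2) * s
      + (1 + eta - 2 * eta ^+ 2 + eta + eta ^+ 2 - eta ^+ 3) * l).
  by field.
rewrite gerBl mulr_ge0 ?sqr_ge0// addr_ge0// mulr_ge0//; nra.
Qed.

(** The recursion satisfied by the bounds on the compression error, started at time 1: the value at
    t bounds the error at t + 1, hence the shifted index of [eta_sched]. *)
Fixpoint decay (q e w0 : R) (t : nat) : R :=
  if t is s.+1 then q * decay q e w0 s + q * eta_sched R s.+1 * e else w0.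

Lemma decay_ge0 (q e w0 : R) t : 0 <= q -> 0 <= e -> 0 <= w0 -> 0 <= decay q e w0 t.
Proof.
move=> q0 e0 w0_ge0; elim: t => //= t IH.
by rewrite addr_ge0 ?mulr_ge0// ltW// eta_sched_gt0.
Qed.

Lemma sum_decay_le (gamma0 q e w0 : R) T : 0 < gamma0 -> 0 <= q -> q <= 1 -> 0 <= e ->
  0 <= w0 ->
  (1 - q) * \sum_(1 <= t < T.+1) gamma_sched gamma0 t * decay q e w0 t.-1
    <= gamma0 * w0 + e * \sum_(1 <= t < T.+1) gamma_sched gamma0 t * eta_sched R t.
Proof.
move=> g0 q0 q1 e0 w00.
(* The strengthening keeps the pending term, weighted by the next step size. As step sizes decrease,
   its contracted part q w together with (1 - q) w restores one full w, and the sum telescopes. *)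
suff : (1 - q) * (\sum_(1 <= t < T.+1) gamma_sched gamma0 t * decay q e w0 t.-1)
    + gamma_sched gamma0 T.+1 * decay q e w0 T
    <= gamma0 * w0 + e * \sum_(1 <= t < T.+1) gamma_sched gamma0 t * eta_sched R t.
  apply: le_trans; rewrite lerDl mulr_ge0 ?decay_ge0//.
  by rewrite ltW// gamma_sched_gt0.
elim: T => [|T IH].
  by rewrite !big_geq// !mulr0 addr0 add0r ler_wpM2r// gamma_sched_le.
rewrite !(big_nat_recr T.+1)//= !mulrDr.
set A := \sum_(_ <= _ < _) _ in IH *; set B := \sum_(_ <= _ < _) _ in IH *.
move: IH; set g := gamma_sched gamma0 T.+1; set g' := gamma_sched gamma0 T.+2.
set w := decay q e w0 T; set h := eta_sched R T.+1 => IH.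
have gg' : g' <= g by exact: gamma_sched_homo.
have g'0 : 0 <= g' by rewrite ltW// gamma_sched_gt0.
have h0 : 0 <= h by rewrite ltW// eta_sched_gt0.
have w_ge0 : 0 <= w by exact: decay_ge0.
have s1 : g' * (q * w) <= g * (q * w) by rewrite ler_wpM2r// mulr_ge0.
have s2 : g' * (q * h * e) <= g * (h * e).
  by rewrite ler_pM// ?mulr_ge0// ler_wpM2r// ler_piMl.
nra.
Qed.

End Schedules.

(** * Compressors and the random index *)

Lemma sigma_of_measurable (dO dT : measure_display) (Omega : measurableType dO)
    (T : measurableType dT) (f : Omega -> T) :
  measurable_fun setT f -> sigma_of f `<=` measurable.
Proof. by move=> mf _ [B mB <-]; exact: mf. Qed.

Lemma expectation_mean_le (R : realType) (dO : measure_display)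
    (Omega : measurableType dO) (P : probability Omega R) (f : Omega -> R) (a : R) :
  ('E_P[f] <= a%:E)%E <-> mean_le P f a.
Proof. by rewrite unlock. Qed.

(** Inversion is discontinuous at 0; as the real power -1 it is measurable everywhere, including at
    its default value 0. *)
Lemma measurable_inv_enorm (R : realType) d dS (S : measurableType dS)
    (Y : S -> 'rV[R]_d) :
  measurable_row Y -> measurable_fun setT (fun w => (enorm (Y w))^-1).
Proof.
move=> mY; under eq_fun do rewrite -powR_inv1 ?enorm_ge0//.
exact: (measurableT_comp (measurable_powR _) (measurable_enorm mY)).
Qed.

Section Compression.
Context {R : realType} {d : nat} {dO : measure_display} {Omega : measurableType dO}
  (P : probability Omega R) {dZ : measure_display} {Z : measurableType dZ}
  (Q : probability Z R) (c : Z -> 'rV[R]_d -> 'rV[R]_d) (alpha : R).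

(** With the input Y frozen, contractivity bounds the second moment over the seed and Jensen turns
    it into a first moment with factor sqrt (1 - alpha); integrating over Y concludes. Only
    independence of the seed from its input is required. *)
Lemma mean_compression_error (zeta : Omega -> Z) (Y : Omega -> 'rV[R]_d) (b : R) :
  alpha <= 1 -> contractive alpha Q c ->
  measurable_fun setT (fun p : Z * borel_rV R d => (c p.1 (p.2 : 'rV[R]_d) : borel_rV R d)) ->
  has_law P zeta Q -> measurable_row Y ->
  (forall A B, measurable A -> measurable B ->
    P ((zeta @^-1` A) `&` ((Y : Omega -> borel_rV R d) @^-1` B)) =
      P (zeta @^-1` A) * P ((Y : Omega -> borel_rV R d) @^-1` B))%E ->
  mean_le P (fun w => enorm (Y w)) b ->
  mean_le P (fun w => enorm (c (zeta w) (Y w) - Y w)) (Num.sqrt (1 - alpha) * b).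
Proof.
move=> a1 hc mc lawz mY ind Yb.
have mid dS (S : measurableType dS) (y : S -> borel_rV R d) :
  measurable_fun setT y -> measurable_row (y : S -> 'rV[R]_d) by move/measurable_borel_rVP.
pose h (p : Z * borel_rV R d) : \bar R := (enorm (c p.1 (p.2 : 'rV[R]_d) - p.2))%:E.
have mh : measurable_fun setT h.
  apply/measurable_EFinP; apply: measurable_enorm; apply: measurable_rowB; first exact: mid.
  by apply: mid; exact: measurable_snd.
have h0 p : (0 <= h p)%E by rewrite lee_fin enorm_ge0.
have mYb : measurable_fun setT (Y : Omega -> borel_rV R d) by apply/measurable_borel_rVP.
rewrite /mean_le.
have -> : (\int[P]_w (enorm (c (zeta w) (Y w) - Y w))%:E = \int[P]_w h (zeta w, Y w))%E by [].
rewrite (@integral_independent _ _ _ P _ _ Z (borel_rV R d) Q zeta Y h)//.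
have mY1 : measurable_fun setT (fun w => enorm (Y w)) by exact: measurable_enorm.
apply: (@le_trans _ _ (\int[P]_w (Num.sqrt (1 - alpha) * enorm (Y w))%:E)%E); last first.
  by apply: mean_leZ => // w; exact: enorm_ge0.
apply: ge0_le_integral => //.
- by move=> w _; exact: integral_ge0.
- exact: (measurableT_comp (measurable_fun_fubini_tonelli_G (m1 := Q) h mh h0)).
- by apply/measurable_EFinP; exact: measurable_funM.
- move=> w _; rewrite /h/=; apply: mean_le_of_sq.
  + by rewrite mulr_ge0 ?sqrtr_ge0 ?enorm_ge0.
  + apply: measurable_enorm; apply: measurable_rowB; last exact: measurable_row_cst.
    exact: mid (measurableT_comp mc (pair2_measurable (Y w : borel_rV R d))).
  + by move=> z; exact: enorm_ge0.
  + rewrite exprMn sqr_sqrtr ?subr_ge0//; apply/expectation_mean_le; exact: hc.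
Qed.

End Compression.

Section RandomIndex.
Context {R : realType} {d : nat} {dO : measure_display} {Omega : measurableType dO}
  (P : probability Omega R).

(** The event is coded as a boolean variable, so that the freezing lemma applies with the law of its
    indicator. *)
Lemma integral_event_independent (E : set Omega) (Y : Omega -> 'rV[R]_d)
    (h : 'rV[R]_d -> R) :
  measurable E -> measurable_row Y ->
  measurable_fun setT (h : borel_rV R d -> R) -> (forall v, 0 <= h v) ->
  (forall B, measurable B -> P (E `&` ((Y : Omega -> borel_rV R d) @^-1` B)) =
      P E * P ((Y : Omega -> borel_rV R d) @^-1` B))%E ->
  (\int[P]_w (\1_E w * h (Y w))%:E = P E * \int[P]_w (h (Y w))%:E)%E.
Proof.
move=> mE mY mh h0 ind.
pose X w := w \in E.
have XE : X @^-1` [set true] = E by apply/seteqP; split => w; [exact: set_mem|exact: mem_set].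
have mX : measurable_fun setT X.
  by apply: (@measurable_fun_bool _ _ _ _ true) => //; rewrite setTI XE.
pose X' : {mfun Omega >-> bool} := HB.pack X (isMeasurableFun.Build _ _ _ _ X mX).
pose k (p : bool * borel_rV R d) : \bar R := (p.1%:R * h p.2)%:E.
have k0 p : (0 <= k p)%E by rewrite lee_fin mulr_ge0// ler0n.
have mb : measurable_fun setT (fun b : bool => b%:R : R) by [].
have mk : measurable_fun setT k.
  apply/measurable_EFinP; apply: measurable_funM.
    exact: (measurableT_comp mb measurable_fst).
  exact: (measurableT_comp mh measurable_snd).
have mYb : measurable_fun setT (Y : Omega -> borel_rV R d) by apply/measurable_borel_rVP.
have -> : (\int[P]_w (\1_E w * h (Y w))%:E = \int[P]_w k (X w, Y w))%E by [].
have inner y : (\int[distribution P X']_a k (a, y) = P E * (h y)%:E)%E.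
  have mky : measurable_fun setT (fun a => k (a, y)).
    exact: (measurableT_comp mk (@pair2_measurable _ _ bool (borel_rV R d) y)).
  rewrite (@ge0_integral_distribution _ _ _ _ _ P X' _ mky)//.
  rewrite (_ : (fun a => k (a, y)) \o X' = (fun w => (h y)%:E * (\1_E w)%:E)%E); last first.
    by apply/funext => w; rewrite /k/= -EFinM mulrC.
  have mI : measurable_fun setT (fun w => (\1_E w)%:E : \bar R).
    by apply/measurable_EFinP; exact: measurable_indic.
  have hy0 : (0 <= (h y)%:E)%E by rewrite lee_fin.
  have I0 w : setT w -> (0 <= (\1_E w : R)%:E)%E by rewrite lee_fin.
  rewrite (ge0_integralZl P measurableT mI I0 hy0).
  by rewrite integral_indic// setIT muleC.
rewrite (@integral_independent _ _ _ P _ _ bool (borel_rV R d) (distribution P X') X Y k)//.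
  under eq_integral do rewrite inner.
  rewrite ge0_integralZl//; last by move=> w _; rewrite lee_fin.
  by apply/measurable_EFinP; exact: (measurableT_comp mh mYb).
move=> A B mA mB.
have YB : measurable (Y @^-1` B) by rewrite -[X in measurable X]setTI; exact: mYb.
(* The four sets of booleans pull back to the whole space, E, its complement and the empty set; only
   the complement needs a computation. *)
have [At|At] := pselect (A true); have [Af|Af] := pselect (A false).
- rewrite (_ : X @^-1` A = setT); last by apply/seteqP; split=> // w _ /=; case: (X w).
  by rewrite setTI probability_setT mul1e.
- rewrite (_ : X @^-1` A = E); first exact: ind.
  by rewrite -XE; apply/seteqP; split=> w /=; [case: (X w)|move=> ->].
- rewrite (_ : X @^-1` A = ~` E); last first.
    rewrite -XE; apply/seteqP; split=> w /=; first by case: (X w).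
    by case: (X w) => // /(_ erefl).
  rewrite setIC -setDE measureD//; last by rewrite -ge0_fin_numE// fin_num_measure.
  have PE : P E \is a fin_num by rewrite fin_num_measure.
  have PY : P (Y @^-1` B) \is a fin_num by rewrite fin_num_measure.
  rewrite probability_setC// [Y @^-1` B `&` E]setIC [X in (_ - X)%E](ind B mB).
  move: PY; set p := P (Y @^-1` B) => PY.
  change (p - P E * p = (1 - P E) * p)%E.
  case: (P E) PE => [a||]// _; case: p PY => [b||]// _.
  by rewrite -EFinM -!EFinB -EFinM mulrBl mul1r.
- rewrite (_ : X @^-1` A = set0); last by apply/seteqP; split=> // w /=; case: (X w).
  by rewrite set0I measure0 mul0e.
Qed.

End RandomIndex.

(** * The algorithm *)

Section Algorithm.
Context {R : realType} {n d : nat} (hn : (0 < n)%N)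
  {dX : 'I_n -> measure_display} {X : forall i, measurableType (dX i)}
  {D : forall i, probability (X i) R}
  {F : forall i, X i -> 'rV[R]_d -> R} {fi : 'I_n -> 'rV[R]_d -> R}.
Context (hF_smooth : forall i a, twice_differentiable (@F i a))
  (hfi_smooth : forall i, twice_differentiable (fi i)).
Context {dZ : nat -> 'I_n -> measure_display}
  {Z : forall t i, measurableType (dZ t i)}
  {Q : forall t i, probability (Z t i) R}
  {c : forall t i, Z t i -> 'rV[R]_d -> 'rV[R]_d}.
Context (hc_meas : forall t i, measurable_fun setT
       (fun p : Z t.+1 i * borel_rV R d =>
          (@c t.+1 i p.1 (p.2 : 'rV[R]_d) : borel_rV R d)))
  {alpha : R} (halpha : 0 < alpha <= 1)
  (h_contr : forall t i, contractive alpha (Q t.+1 i) (@c t.+1 i)).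
Context {Li : 'I_n -> R} (hLi : forall i, 0 < Li i)
  (hfi_lip : forall i, grad_lipschitz (Li i) (fi i)).
Context {L : R} (hL : 0 < L) (hf_lip : grad_lipschitz L (fun x => avgR (fi^~ x))).
Context {sigma : R} (hsg : 0 <= sigma)
  (h_grad_mean : forall i x, has_mean (D i) (fun a => grad (@F i a) x) (grad (fi i) x))
  (h_grad_var : forall i x,
    ('E_(D i)[fun a => (enorm (grad (@F i a) x - grad (fi i) x) ^+ 2)%R]
         <= (sigma ^+ 2)%:E)%E).
Context {gamma0 : R} (hgamma0 : 0 < gamma0)
  {x0 : 'rV[R]_d} {v0 g0 : 'I_n -> 'rV[R]_d}.
Context {dO : measure_display} {Omega : measurableType dO} {P : probability Omega R}
  {xi : nat -> forall i, Omega -> X i} {zeta : forall t i, Omega -> Z t i}.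
Context (hxi_law : forall t i, has_law P (xi t.+1 i) (D i))
  (hzeta_law : forall t i, has_law P (zeta t.+1 i) (Q t.+1 i)).

Let St := ef21_sgdm (gamma_sched gamma0) (@eta_sched R) x0 v0 g0 F c xi zeta.

Context (hxi_indep : forall t, independent_family P (xi t.+1) (history xi zeta t))
  (hzeta_indep : forall t i,
       independent P (sigma_of (zeta t.+1 i))
         <<s history xi zeta t `|`
             sigma_of (fun w => mom (St t.+1 w) i - est (St t w) i
                                  : borel_rV R d) >>).

Let gm := gamma_sched gamma0.
Let et := @eta_sched R.
Let f x := avgR (fi^~ x).
Let q := Num.sqrt (1 - alpha).

(** * Measurability of the iterates with respect to the history *)

Let H t : set (set Omega) := [set A | exists s i, (1 <= s <= t)%N /\
                 (sigma_of (xi s i) A \/ sigma_of (zeta s i) A)].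

Let HO t : H t `<=` measurable.
Proof.
move=> A [[|s] [i [// _ [|]]]]; apply: sigma_of_measurable.
  by have [] := hxi_law s i.
by have [] := hzeta_law s i.
Qed.

Let HS t : H t `<=` <<s H t.+1 >>.
Proof.
move=> A [s [i [/andP[s0 st] HA]]]; apply: sub_sigma_algebra; exists s, i; split=> //.
by rewrite s0 (leq_trans st).
Qed.

Let lift_row t (Y : Omega -> 'rV[R]_d) :
  measurable_row (Y : g_sigma_algebraType (H t) -> _) ->
  measurable_row (Y : g_sigma_algebraType (H t.+1) -> _).
Proof. by move=> mY j; exact: (measurable_fun_sub_sigma (@HS t) (mY j)). Qed.

Let ambient_row t (Y : Omega -> 'rV[R]_d) :
  measurable_row (Y : g_sigma_algebraType (H t) -> _) -> measurable_row Y.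
Proof. by move=> mY j; exact: (measurable_fun_ambient (@HO t) (mY j)). Qed.

Let mxi t i : measurable_fun setT (xi t.+1 i : g_sigma_algebraType (H t.+1) -> X i).
Proof.
apply: measurable_fun_sigma_of => A XA; apply: sub_sigma_algebra.
by exists t.+1, i; rewrite leqnn; split=> //; left.
Qed.

Let mzeta t i : measurable_fun setT (zeta t.+1 i : g_sigma_algebraType (H t.+1) -> Z t.+1 i).
Proof.
apply: measurable_fun_sigma_of => A XA; apply: sub_sigma_algebra.
by exists t.+1, i; rewrite leqnn; split=> //; right.
Qed.

Let cF i a : continuous (grad (@F i a)).
Proof. by move=> x; apply: differentiable_continuous; have [] := hF_smooth a x. Qed.

Let cfi i : continuous (grad (fi i)).
Proof. by move=> x; apply: differentiable_continuous; have [] := hfi_smooth i x. Qed.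

Let h_var i x :
  mean_le (D i) (fun a => enorm (grad (@F i a) x - grad (fi i) x) ^+ 2) (sigma ^+ 2).
Proof. exact/expectation_mean_le/h_grad_var. Qed.

Let St_pos t w : pos (St t.+1 w) = pos (St t w) -
  gm t *: ((enorm (avg (est (St t w))))^-1 *: avg (est (St t w))).
Proof. by []. Qed.

Let St_mom t i w : mom (St t.+1 w) i =
  (1 - et t) *: mom (St t w) i + et t *: grad (@F i (xi t.+1 i w)) (pos (St t.+1 w)).
Proof. by []. Qed.

Let St_est t i w : est (St t.+1 w) i =
  est (St t w) i + @c t.+1 i (zeta t.+1 i w) (mom (St t.+1 w) i - est (St t w) i).
Proof. by []. Qed.

(** The position of index t + 1 is already known at time t, because the step uses the estimators of
    time t. The samples of time t + 1 are therefore fresh at the point where they are evaluated. *)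
Let state_measurable t :
  [/\ measurable_row ((fun w => pos (St t w)) : g_sigma_algebraType (H t) -> _),
      measurable_row ((fun w => pos (St t.+1 w)) : g_sigma_algebraType (H t) -> _),
      forall i, measurable_row ((fun w => mom (St t w) i) : g_sigma_algebraType (H t) -> _) &
      forall i, measurable_row ((fun w => est (St t w) i) : g_sigma_algebraType (H t) -> _)].
Proof.
have next s : measurable_row ((fun w => pos (St s w)) : g_sigma_algebraType (H s) -> _) ->
    (forall i, measurable_row ((fun w => est (St s w) i) : g_sigma_algebraType (H s) -> _)) ->
    measurable_row ((fun w => pos (St s.+1 w)) : g_sigma_algebraType (H s) -> _).
  move=> mp me; under eq_fun do rewrite St_pos.
  have mg : measurable_row ((fun w => avg (est (St s w))) : g_sigma_algebraType (H s) -> _).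
    exact: (measurable_row_avg me).
  apply: measurable_rowB => //; apply: measurable_rowZ; first exact: measurable_cst.
  by apply: measurable_rowZ => //; exact: measurable_inv_enorm.
elim: t => [|t [mp mp' mm me]].
  have m0 : measurable_row ((fun w => pos (St 0 w)) : g_sigma_algebraType (H 0) -> _).
    exact: measurable_row_cst.
  have e0 i : measurable_row ((fun w => est (St 0 w) i) : g_sigma_algebraType (H 0) -> _).
    exact: measurable_row_cst.
  split=> //; first exact: next.
  by move=> i; exact: measurable_row_cst.
have mpS := lift_row mp'.
have mmS i : measurable_row ((fun w => mom (St t.+1 w) i) : g_sigma_algebraType (H t.+1) -> _).
  under eq_fun do rewrite St_mom.
  apply: measurable_rowD; apply: measurable_rowZ; first exact: measurable_cst.
  - exact: lift_row (mm i).
  - exact: measurable_cst.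
  - exact: (measurable_oracle (@cF i) (@h_grad_mean i) (@mxi t i) mpS).
have meS i : measurable_row ((fun w => est (St t.+1 w) i) : g_sigma_algebraType (H t.+1) -> _).
  under eq_fun do rewrite St_est.
  apply: measurable_rowD; first exact: lift_row (me i).
  apply/measurable_borel_rVP.
  have mY : measurable_row ((fun w => mom (St t.+1 w) i - est (St t w) i) :
      g_sigma_algebraType (H t.+1) -> _).
    by apply: measurable_rowB => //; exact: lift_row (me i).
  move/measurable_borel_rVP in mY.
  exact: (measurableT_comp (@hc_meas t i) (measurable_fun_pair (@mzeta t i) mY)).
by split=> //; exact: next.
Qed.

Let mpos t : measurable_row ((fun w => pos (St t w)) : g_sigma_algebraType (H t) -> _).
Proof. by have [] := state_measurable t. Qed.

Let mposS t : measurable_row ((fun w => pos (St t.+1 w)) : g_sigma_algebraType (H t) -> _).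
Proof. by have [] := state_measurable t. Qed.

Let mmom t i : measurable_row ((fun w => mom (St t w) i) : g_sigma_algebraType (H t) -> _).
Proof. by have [] := state_measurable t. Qed.

Let mest t i : measurable_row ((fun w => est (St t w) i) : g_sigma_algebraType (H t) -> _).
Proof. by have [] := state_measurable t. Qed.

Let mgrad t i : measurable_row (fun w => grad (fi i) (pos (St t w))).
Proof. exact: (measurable_continuous_row (@cfi i) (ambient_row (@mpos t))). Qed.

Let xi_indep t i A B : measurable A -> <<s H t >> B ->
  (P ((xi t.+1 i @^-1` A) `&` B) = P (xi t.+1 i @^-1` A) * P B)%E.
Proof.
move=> mA HB.
have sT : <<s H t >> setT by exact: (@measurableT _ (g_sigma_algebraType (H t))).
have sI : setI_closed <<s H t >>.
  by move=> ? ?; exact: (@measurableI _ (g_sigma_algebraType (H t))).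
have mX j : measurable_fun setT (xi t.+1 j) by case: (hxi_law t j).
have E : (<<s family_events (xi t.+1) <<s H t>> i >>) B.
  by apply: sub_sigma_algebra; exact: sub_family_events.
exact: (independent_family_events sT sI (sigma_sub_measurable (@HO t)) mX (k := i) (@hxi_indep t) mA E).
Qed.

(** * Oracle noise and momentum error of a single client *)

Let noise t i w := grad (@F i (xi t.+1 i w)) (pos (St t.+1 w)) - grad (fi i) (pos (St t.+1 w)).

Let mnoise t i : measurable_row (noise t i).
Proof.
apply: (measurable_noise (@cF i) (@cfi i) (@h_grad_mean i)); last exact: (ambient_row (@mpos t.+1)).
by case: (hxi_law t i).
Qed.

Let mean_noise_le t i : mean_le P (fun w => enorm (noise t i w)) sigma.
Proof.
exact: (mean_noise (@cF i) (@cfi i) (@h_grad_mean i) (@h_var i) (@HO t)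
  (hxi_law t i) (@xi_indep t i) hsg (@mposS t)).
Qed.

Let gm_ge0 t : 0 <= gm t. Proof. by rewrite ltW// gamma_sched_gt0. Qed.
Let et_ge0 t : 0 <= et t. Proof. by rewrite ltW// eta_sched_gt0. Qed.
Let et_le1 t : et t <= 1. Proof. exact: eta_sched_le1. Qed.
Let q_ge0 : 0 <= q. Proof. exact: sqrtr_ge0. Qed.
Let q_le1 : q <= 1.
Proof.
rewrite -[leRHS]sqrtr1 ler_wsqrtr// gerBl ltW//.
by case/andP: halpha.
Qed.

Let grad_step t i w :
  enorm (grad (fi i) (pos (St t.+1 w)) - grad (fi i) (pos (St t w))) <= Li i * gm t.
Proof. by rewrite St_pos; apply: ler_lip_step => //; rewrite ltW. Qed.

Let U t i w := enorm (mom (St t w) i - grad (fi i) (pos (St t w))).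

Let mU t i : measurable_fun setT (U t i).
Proof.
apply: measurable_enorm; apply: measurable_rowB; last exact: mgrad.
exact: (ambient_row (@mmom t i)).
Qed.

Let U_ge0 t i w : 0 <= U t i w. Proof. exact: enorm_ge0. Qed.

Let mNn t i : measurable_fun setT (fun w => enorm (noise t i w)).
Proof. exact/measurable_enorm/mnoise. Qed.

(** The new error is (1 - eta) times the old error shifted by the gradient drift, plus eta times the
    noise; the triangle inequality suffices since no averaging is sought here. *)
Let U_step t i a : mean_le P (U t i) a ->
  mean_le P (U t.+1 i) ((1 - et t) * (a + Li i * gm t) + et t * sigma).
Proof.
move=> Ua; have e1 : 0 <= 1 - et t by rewrite subr_ge0.
have lg : 0 <= Li i * gm t by rewrite mulr_ge0// ltW.
apply: (@mean_le_mono _ _ _ _ _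
  (fun w => (1 - et t) * (U t i w + Li i * gm t) + et t * enorm (noise t i w))) => //.
- apply: measurable_funD; last exact: measurable_funM.
  by apply: measurable_funM => //; exact: measurable_funD.
- move=> w; rewrite U_ge0/= /U St_mom.
  set a1 := mom _ _; set b := grad (fi i) (pos (St t w)).
  set b' := grad (fi i) (pos (St t.+1 w)).
  have -> : (1 - et t) *: a1 + et t *: grad (@F i (xi t.+1 i w)) (pos (St t.+1 w)) - b' =
      (1 - et t) *: (a1 - b - (b' - b)) + et t *: noise t i w.
    rewrite /noise -/b' opprB addrA subrK scalerBr [in RHS]scalerBr.
    by rewrite addrACA -opprD -scalerDl subrK scale1r.
  rewrite (le_trans (ler_enormD _ _))// !enormZ !ger0_norm// lerD2r ler_wpM2l//.
  rewrite (le_trans (ler_enormD _ _))// lerD2l enormN; exact: grad_step.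
- apply: mean_leD.
  + by apply: measurable_funM => //; exact: measurable_funD.
  + exact: measurable_funM.
  + by move=> w; rewrite mulr_ge0// addr_ge0.
  + by move=> w; rewrite mulr_ge0// enorm_ge0.
  + apply: mean_leZ => //; first exact: measurable_funD.
      by move=> w; rewrite addr_ge0.
    by apply: mean_leD => //; exact: mean_le_cst.
  + by apply: mean_leZ => // w; exact: enorm_ge0.
Qed.

Let U_bound t i : mean_le P (U t.+1 i) (sigma + Li i * gamma0).
Proof.
have L0 := ltW (hLi i).
elim: t => [|t IH].
  (* The initial state is deterministic, so [point] merely names its value; it disappears because
     eta_0 = 1. *)
  have := @U_step 0 i _ (mean_le_cst P (U 0 i point)).
  rewrite /et eta_sched0 subrr mul0r add0r mul1r => /le_trans; apply.
  by rewrite lee_fin lerDl mulr_ge0// ltW.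
move/le_trans : (U_step IH); apply; rewrite lee_fin.
(* By gamma_t <= gamma0 eta_t, the drift is paid for by the fraction eta_t of Li gamma0 that the
   contraction releases. *)
have h1 : gm t.+1 <= gamma0 * et t.+1 by exact: gamma_sched_le_eta.
have h2 := ler_wpM2l L0 h1.
have h3 : (1 - et t.+1) * (Li i * gm t.+1) <= Li i * gm t.+1.
  have e1 : 1 - et t.+1 <= 1 by rewrite gerBl.
  by apply: ler_piMl => //; exact: mulr_ge0.
nra.
Qed.

(** * Compression error of a single client *)

Let W t i w := enorm (est (St t w) i - mom (St t w) i).

Let mW t i : measurable_fun setT (W t i).
Proof.
by apply: measurable_enorm; apply: measurable_rowB;
  [exact: (ambient_row (@mest t i))|exact: (ambient_row (@mmom t i))].
Qed.

Let W_ge0 t i w : 0 <= W t i w. Proof. exact: enorm_ge0. Qed.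

(** The error equals that of compressing Y = v^(t+1) - g^t, and Y differs from v^t - g^t by eta_t
    times noise, drift and old momentum error. Since Y involves the new samples, the seed must be
    independent of Y as well as of the history. *)
Let W_step t i a u : mean_le P (W t i) a -> mean_le P (U t i) u ->
  mean_le P (W t.+1 i) (q * (a + et t * (sigma + (Li i * gm t + u)))).
Proof.
move=> Wa Uu; have lg : 0 <= Li i * gm t by rewrite mulr_ge0// ltW.
pose Y w := mom (St t.+1 w) i - est (St t w) i.
have mY : measurable_row Y.
  apply: measurable_rowB; first exact: (ambient_row (@mmom t.+1 i)).
  exact: (ambient_row (@mest t i)).
have WE w : W t.+1 i w = enorm (@c t.+1 i (zeta t.+1 i w) (Y w) - Y w).
  by rewrite /W St_est /Y opprB [in RHS]addrCA addrA.
rewrite /mean_le; under eq_integral do rewrite WE.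
apply: (mean_compression_error (Q := Q t.+1 i)) => //.
- by case/andP: halpha.
- move=> A B mA mB; apply: hzeta_indep; first by exists A; rewrite ?setTI.
  by apply: sub_sigma_algebra; right; exists B; rewrite ?setTI.
apply: (@mean_le_mono _ _ _ _ _ (fun w => W t i w +
    et t * (enorm (noise t i w) + (Li i * gm t + U t i w)))) => //.
- exact: measurable_enorm.
- apply: measurable_funD => //; apply: measurable_funM => //.
  by apply: measurable_funD => //; exact: measurable_funD.
- move=> w; rewrite enorm_ge0/= /W /U /Y St_mom.
  set a1 := mom _ _; set b := grad (fi i) (pos (St t w)).
  set b' := grad (fi i) (pos (St t.+1 w)); set e1 := est _ _.
  have alg (G : 'rV[R]_d) : (1 - et t) *: a1 + et t *: G - e1 =
      (a1 - e1) + et t *: (G - b' + ((b' - b) + (b - a1))).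
    by apply/rowP => j; move: a1 b b' e1 => a1 b b' e1; rewrite !mxE; ring.
  rewrite alg -/(noise t i w).
  rewrite (le_trans (ler_enormD _ _))// enormB lerD2l enormZ ger0_norm// ler_wpM2l//.
  rewrite (le_trans (ler_enormD _ _))// lerD2l (le_trans (ler_enormD _ _))//.
  by rewrite (enormB b) lerD2r; exact: grad_step.
- have m1 : measurable_fun setT (fun w => Li i * gm t + U t i w) by exact: measurable_funD.
  have p1 w : 0 <= Li i * gm t + U t i w by rewrite addr_ge0.
  have m2 : measurable_fun setT (fun w => enorm (noise t i w) + (Li i * gm t + U t i w)).
    exact: measurable_funD.
  have p2 w : 0 <= enorm (noise t i w) + (Li i * gm t + U t i w).
    by rewrite addr_ge0 ?enorm_ge0.
  apply: mean_leD => //; first exact: measurable_funM.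
    by move=> w; rewrite mulr_ge0.
  apply: mean_leZ => //; apply: mean_leD => //.
  + by move=> w; exact: enorm_ge0.
  + by apply: mean_leD => //; exact: mean_le_cst.
Qed.

(** A bound for the compression error at time 1. The factor q is kept on the initial errors, because
    [V0] weighs the initial momentum error with q; on the rest it is dropped. *)
Let w1 i := q * (enorm (g0 i - v0 i) + enorm (v0 i - grad (fi i) x0)) + (sigma + Li i * gamma0).

Let W_bound t i :
  mean_le P (W t.+1 i) (decay q (2 * (sigma + Li i * gamma0)) (w1 i) t).
Proof.
have L0 := ltW (hLi i).
elim: t => [|t IH] /=.
  have := @W_step 0 i _ _ (mean_le_cst P (W 0 i point)) (mean_le_cst P (U 0 i point)).
  rewrite /gm gamma_sched0 /et eta_sched0 mul1r => /le_trans; apply.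
  rewrite lee_fin /w1 /W /U /=.
  have A := enorm_ge0 (g0 i - v0 i); have B := enorm_ge0 (v0 i - grad (fi i) x0).
  have s1 : q * (sigma + Li i * gamma0) <= sigma + Li i * gamma0.
    by rewrite ler_piMl// addr_ge0// mulr_ge0// ltW.
  nra.
have := W_step IH (U_bound t i); move/le_trans; apply; rewrite lee_fin.
rewrite mulrDr lerD2l -mulrA ler_wpM2l// ler_wpM2l//.
have : Li i * gm t.+1 <= Li i * gamma0 by rewrite ler_wpM2l// gamma_sched_le.
lra.
Qed.

(** * Averaged momentum error *)

Let df x : forall i, differentiable (fi i) x.
Proof. by move=> i; have [] := hfi_smooth i x. Qed.

Let dff x : differentiable f x.
Proof. exact: differentiable_avgR. Qed.

Let gradfE x : grad f x = avg (fun i => grad (fi i) x).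
Proof. exact: grad_avgR. Qed.

Let V t w := avg (mom (St t w)) - grad f (pos (St t w)).

Let mV t : measurable_row (V t).
Proof.
apply: measurable_rowB; first by apply: measurable_row_avg => i; exact: (ambient_row (@mmom t i)).
under eq_fun do rewrite gradfE; apply: measurable_row_avg => i; exact: mgrad.
Qed.

Let mV2 t : measurable_fun setT (fun w => enorm (V t w) ^+ 2).
Proof. exact/measurable_funX/measurable_enorm/mV. Qed.

Let n_gt0 : 0 < n%:R :> R. Proof. by rewrite ltr0n. Qed.

Let V_succ t w : V t.+1 w =
  (1 - et t) *: (avg (mom (St t w)) - grad f (pos (St t.+1 w))) +
  (et t / n%:R) *: \sum_(i < n) noise t i w.
Proof.
have -> : (et t / n%:R) *: \sum_(i < n) noise t i w = et t *: avg (noise t ^~ w).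
  by rewrite /avg scalerA.
rewrite /V gradfE; have -> : avg (mom (St t.+1 w)) = (1 - et t) *: avg (mom (St t w)) +
    et t *: avg (fun i => grad (@F i (xi t.+1 i w)) (pos (St t.+1 w))).
  by rewrite !avgZ avgD.
rewrite /noise -avgB; move: (avg _) (avg (fun i => grad (fi i) _)) (avg _) => a b G.
by apply/rowP => j; rewrite !mxE; ring.
Qed.

Let V_step t a : mean_le P (fun w => enorm (V t w) ^+ 2) a ->
  mean_le P (fun w => enorm (V t.+1 w) ^+ 2)
    ((1 - et t) ^+ 2 * ((1 + et t) * a + (1 + (et t)^-1) * (L * gm t) ^+ 2)
      + et t ^+ 2 * (sigma ^+ 2 / n%:R)).
Proof.
move=> Va; have e0 : 0 < et t by exact: eta_sched_gt0.
have c1 : 0 <= 1 + et t by rewrite addr_ge0.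
have c2 : 0 <= (1 + (et t)^-1) * (L * gm t) ^+ 2.
  by rewrite mulr_ge0 ?sqr_ge0// addr_ge0// invr_ge0.
pose A w := (1 - et t) *: (avg (mom (St t w)) - grad f (pos (St t.+1 w))).
have mA : measurable_row (A : g_sigma_algebraType (H t) -> _).
  apply: measurable_rowZ; first exact: measurable_cst.
  apply: measurable_rowB; first by apply: measurable_row_avg => i; exact: (@mmom t i).
  under eq_fun do rewrite gradfE; apply: measurable_row_avg => i.
  exact: (measurable_continuous_row (@cfi i) (@mposS t)).
(* There are n centered noises of weight eta_t / n: their variances add up to a fraction 1/n of that
   of one client. *)
have -> : et t ^+ 2 * (sigma ^+ 2 / n%:R) = n%:R * ((et t / n%:R) ^+ 2 * sigma ^+ 2).
  by field; rewrite gt_eqF.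
under [X in mean_le _ X]eq_fun do rewrite V_succ.
apply: (@mean_sq_add_noises _ _ _ _ _ P _ _ D (fun i a x => grad (@F i a) x)
  (fun i => grad (fi i)) sigma cF cfi h_grad_mean h_var _ _ (@HO t) (hxi_law t)
  (@hxi_indep t) A (fun w => pos (St t.+1 w)) (et t / n%:R) _ mA (@mposS t)).
apply: (@mean_le_mono _ _ _ _ _ (fun w => (1 - et t) ^+ 2 *
  ((1 + et t) * enorm (V t w) ^+ 2 + (1 + (et t)^-1) * (L * gm t) ^+ 2))).
- by apply: measurable_funX; apply: measurable_enorm; exact: (ambient_row mA).
- apply: measurable_funM => //; apply: measurable_funD => //.
  exact: measurable_funM.
- move=> w; rewrite sqr_ge0/= /A enormZ exprMn -normrX ger0_norm ?sqr_ge0//.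
  rewrite ler_wpM2l ?sqr_ge0//.
  have -> : avg (mom (St t w)) - grad f (pos (St t.+1 w)) =
      V t w + (grad f (pos (St t w)) - grad f (pos (St t.+1 w))).
    by rewrite /V addrA subrK.
  rewrite (le_trans (enorm_sqrD_young _ _ e0))// lerD2l ler_wpM2l ?addr_ge0 ?invr_ge0//.
  have lg : 0 <= L * gm t by rewrite mulr_ge0// ltW.
  rewrite ler_pXn2r ?nnegrE ?enorm_ge0// enormB St_pos.
  by apply: ler_lip_step => //; exact: ltW.
- apply: mean_leZ; last first.
  + apply: mean_leD.
    * exact: measurable_funM.
    * by [].
    * by move=> w; rewrite mulr_ge0 ?sqr_ge0.
    * by move=> w.
    * by apply: mean_leZ => // w; exact: sqr_ge0.
    * exact: mean_le_cst.
  + exact: sqr_ge0.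
  + by move=> w; rewrite addr_ge0// mulr_ge0 ?sqr_ge0.
  + by apply: measurable_funD => //; exact: measurable_funM.
Qed.

Let s0 := sigma ^+ 2 / n%:R.
Let l0 := L ^+ 2 * gamma0 ^+ 2.

Let s0_ge0 : 0 <= s0. Proof. by rewrite divr_ge0 ?sqr_ge0. Qed.
Let l0_ge0 : 0 <= l0. Proof. by rewrite mulr_ge0 ?sqr_ge0. Qed.

Let V_sq_bound t : mean_le P (fun w => enorm (V t.+1 w) ^+ 2) (2 * et t.+1 * (s0 + l0)).
Proof.
elim: t => [|t IH].
  (* As eta_0 = 1, only the averaged noise s0 survives the first step, and 2 eta_1 >= 1 covers
     it. *)
  have := @V_step 0 _ (mean_le_cst P (enorm (V 0 point) ^+ 2)).
  rewrite /et eta_sched0 subrr expr0n/= mul0r add0r expr1n mul1r -/s0.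
  move/le_trans; apply; rewrite lee_fin.
  have e1 := @eta_sched1_ge R.
  have : 1 * (s0 + l0) <= 2 * eta_sched R 1 * (s0 + l0).
    by rewrite ler_wpM2r ?addr_ge0//; lra.
  by have := l0_ge0; lra.
move/le_trans : (V_step IH); apply; rewrite lee_fin.
apply: momentum_sq_step => //; [exact: eta_sched_gt0|exact: eta_sched_decr|].
by rewrite exprMn /gm gamma_sched_sqr /l0 /et; ring.
Qed.

Let nu := sigma / Num.sqrt n%:R + L * gamma0.

Let nu_ge0 : 0 <= nu.
Proof. by rewrite addr_ge0 ?divr_ge0 ?sqrtr_ge0 ?mulr_ge0// ltW. Qed.

Let V_bound t : mean_le P (fun w => enorm (V t.+1 w)) (2 * sched_root t.+1 * nu).
Proof.
have r0 : 0 <= sched_root t.+1 :> R by rewrite ltW// sched_root_gt0.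
apply: mean_le_of_sq.
- by rewrite !mulr_ge0.
- exact/measurable_enorm/mV.
- by move=> w; exact: enorm_ge0.
move/le_trans : (V_sq_bound t); apply; rewrite lee_fin !exprMn /et eta_schedE.
set r := sched_root t.+1 ^+ 2; have r2 : 0 <= r by exact: sqr_ge0.
have : s0 + l0 <= nu ^+ 2.
  rewrite /nu sqrrD /s0 /l0 expr_div_n sqr_sqrtr ?ler0n// exprMn.
  rewrite lerD2r lerDl mulrn_wge0// mulr_ge0 ?divr_ge0 ?sqrtr_ge0 ?mulr_ge0 ?(ltW hL) ?(ltW hgamma0)//.
have : 0 <= nu ^+ 2 by exact: sqr_ge0.
nra.
Qed.

(** * Descent along a path and its mean *)

Let Gf t w := enorm (grad f (pos (St t w))).

Let mGf t : measurable_fun setT (Gf t).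
Proof.
apply: measurable_enorm; under eq_fun do rewrite gradfE.
by apply: measurable_row_avg => i; exact: mgrad.
Qed.

Let Gf_ge0 t w : 0 <= Gf t w. Proof. exact: enorm_ge0. Qed.

Let descent t w : gm t * Gf t w + f (pos (St t.+1 w)) <=
  f (pos (St t w)) + (2 * (gm t * enorm (V t w)) + 2 * (gm t * avgR (W t ^~ w)) + L * gm t ^+ 2).
Proof.
have := normalized_descent (pos (St t w)) (avg (est (St t w))) dff (ltW hL) hf_lip (gm_ge0 t).
rewrite -St_pos -/(Gf t w) => D1.
have : enorm (grad f (pos (St t w)) - avg (est (St t w))) <= enorm (V t w) + avgR (W t ^~ w).
  rewrite (le_trans (ler_enormB _ (avg (mom (St t w))) _))// enormB lerD2l.
  by rewrite avgB (le_trans (enorm_avg _))//; apply: ler_avgR => i; rewrite enormB.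
move/(ler_wpM2l (gm_ge0 t)); lra.
Qed.

Let path_sum T w : \sum_(t < T) gm t.+1 * Gf t.+1 w + f (pos (St T.+1 w)) <=
  f (pos (St 1 w)) + \sum_(t < T) (2 * (gm t.+1 * enorm (V t.+1 w))
     + 2 * (gm t.+1 * avgR (W t.+1 ^~ w)) + L * gm t.+1 ^+ 2).
Proof.
elim: T => [|T IH]; first by rewrite !big_ord0 add0r addr0.
rewrite !big_ord_recr/=; have := descent T.+1 w; lra.
Qed.

Context (h_inf : has_lbound (range f)).

Let Delta := f x0 - inf (range f).

Let f_inf x : inf (range f) <= f x.
Proof. by apply: ge_inf => //; exists x. Qed.

Let Delta_ge0 : 0 <= Delta. Proof. by rewrite subr_ge0. Qed.

(** The first direction is arbitrary and may ascend, at a cost of at most gamma0 |grad f(x0)| + L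
    gamma0^2. Bounding gamma0 |grad f(x0)| by Delta + L gamma0^2 twice, here and in the weighted
    sum, gives both factors 3. *)
Let first_steps w : gm 0 * Gf 0 w + (f (pos (St 1 w)) - inf (range f)) <=
  3 * Delta + 3 * (L * gamma0 ^+ 2).
Proof.
have g00 : 0 <= gamma0 by exact: ltW.
have A := grad_le_gap x0 dff (ltW hL) hf_lip g00 f_inf.
pose u := (enorm (avg g0))^-1 *: avg g0.
have u1 : enorm u <= 1.
  rewrite enormZ normfV ger0_norm ?enorm_ge0//.
  by have [->|z] := eqVneq (enorm (avg g0)) 0; rewrite ?mulr0// mulVf.
have B := smooth_upper_bound x0 (- (gamma0 *: u)) dff (ltW hL) hf_lip.
have E1 : enorm (- (gamma0 *: u)) <= gamma0.
  by rewrite enormN enormZ ger0_norm// ler_piMr.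
have E2 : L * enorm (- (gamma0 *: u)) ^+ 2 <= L * gamma0 ^+ 2.
  by rewrite ler_wpM2l ?(ltW hL)// ler_pXn2r ?nnegrE ?enorm_ge0.
have E3 : dot (grad f x0) (- (gamma0 *: u)) <= gamma0 * enorm (grad f x0).
  rewrite (le_trans (dot_le _ _))// mulrC ler_wpM2r ?enorm_ge0//.
rewrite /gm gamma_sched0.
have -> : pos (St 1 w) = x0 - gamma0 *: u by rewrite St_pos /gm gamma_sched0.
move: A B E2 E3; rewrite /Gf /Delta /=; lra.
Qed.

Let mean_sum T : mean_le P (fun w => \sum_(t < T.+1) gm t * Gf t w)
  (3 * Delta + 3 * (L * gamma0 ^+ 2) +
   \sum_(t < T) (2 * (gm t.+1 * (2 * sched_root t.+1 * nu))
     + 2 * (gm t.+1 * avgR (fun i => decay q (2 * (sigma + Li i * gamma0)) (w1 i) t))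
     + L * gm t.+1 ^+ 2)).
Proof.
pose S t w := 2 * (gm t.+1 * enorm (V t.+1 w)) + 2 * (gm t.+1 * avgR (W t.+1 ^~ w)) + L * gm t.+1 ^+ 2.
have mVn t : measurable_fun setT (fun w => enorm (V t w)) by exact/measurable_enorm/mV.
have mWn t : measurable_fun setT (fun w => avgR (W t ^~ w)).
  by apply: measurable_funM => //; apply: measurable_sum => i; exact: mW.
have Wn0 t w : 0 <= avgR (W t ^~ w) by apply: avgR_ge0 => i; exact: W_ge0.
have Vn0 t w : 0 <= enorm (V t w) by exact: enorm_ge0.
have p1 t w : 0 <= 2 * (gm t.+1 * enorm (V t.+1 w)) by rewrite mulr_ge0// mulr_ge0.
have p2 t w : 0 <= 2 * (gm t.+1 * avgR (W t.+1 ^~ w)) by rewrite mulr_ge0// mulr_ge0.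
have p3 t : 0 <= L * gm t.+1 ^+ 2 by rewrite mulr_ge0 ?sqr_ge0// ltW.
have m1 t : measurable_fun setT (fun w => 2 * (gm t.+1 * enorm (V t.+1 w))).
  by apply: measurable_funM => //; exact: measurable_funM.
have m2 t : measurable_fun setT (fun w => 2 * (gm t.+1 * avgR (W t.+1 ^~ w))).
  by apply: measurable_funM => //; exact: measurable_funM.
have m12 t : measurable_fun setT (fun w => 2 * (gm t.+1 * enorm (V t.+1 w)) +
  2 * (gm t.+1 * avgR (W t.+1 ^~ w))) by exact: measurable_funD.
have mS t : measurable_fun setT (S t) by exact: measurable_funD.
have S0 t w : 0 <= S t w by rewrite addr_ge0// addr_ge0.
have c0 : 0 <= 3 * Delta + 3 * (L * gamma0 ^+ 2).
  by rewrite addr_ge0 ?mulr_ge0 ?sqr_ge0// ltW.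
apply: (@mean_le_mono _ _ _ _ _ (fun w => 3 * Delta + 3 * (L * gamma0 ^+ 2) + \sum_(t < T) S t w)).
- by apply: measurable_sum => t; exact: measurable_funM.
- by apply: measurable_funD => //; exact: measurable_sum.
- move=> w; apply/andP; split; first by apply: sumr_ge0 => t _; rewrite mulr_ge0.
  rewrite big_ord_recl (_ : \sum_(i < T) _ = \sum_(t < T) gm t.+1 * Gf t.+1 w)//.
  have PS : \sum_(t < T) gm t.+1 * Gf t.+1 w + f (pos (St T.+1 w)) <=
    f (pos (St 1 w)) + \sum_(t < T) S t w := path_sum T w.
  have := first_steps w; have := f_inf (pos (St T.+1 w)); lra.
apply: mean_leD => //.
- exact: measurable_sum.
- by move=> w; exact: sumr_ge0.
- exact: mean_le_cst.
apply: mean_le_sum => // t; apply: mean_leD => //; last exact: mean_le_cst.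
  by move=> w; exact: addr_ge0.
apply: mean_leD => //.
- apply: mean_leZ => //; [exact: measurable_funM|by move=> w; rewrite mulr_ge0|].
  by apply: mean_leZ => //; exact: V_bound.
- apply: mean_leZ => //; [exact: measurable_funM|by move=> w; rewrite mulr_ge0|].
  apply: mean_leZ => //; apply: mean_leZ => //.
  + by apply: measurable_sum => i; exact: mW.
  + by move=> w; apply: sumr_ge0 => i _; exact: W_ge0.
  + apply: mean_le_sum => i; [exact: mW|exact: W_ge0|exact: W_bound].
Qed.

(** * Collecting the constants *)

Let Lam T : R := 1 + ln (T.+1%:R + 1).
Let har T : R := \sum_(t < T) (2 / t.+3%:R).

Let har_ge0 T : 0 <= har T.
Proof. by apply: sumr_ge0 => t _; rewrite divr_ge0. Qed.

Let har_le T : 1 + har T <= 2 * Lam T.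
Proof.
have := @sum_harmonic_le R T.+1 isT; rewrite big_add1/= big_mkord -/(har T) /Lam; lra.
Qed.

Let one_sub_q : alpha / 2 <= 1 - q.
Proof.
case/andP: halpha => a0 a1.
suff : q <= 1 - alpha / 2 by lra.
rewrite -(@ler_pXn2r _ 2)// ?nnegrE ?q_ge0//; last lra.
rewrite /q sqr_sqrtr; last by lra.
by have := sqr_ge0 alpha; rewrite sqrrB; lra.
Qed.

Let one_sub_q_gt0 : 0 < 1 - q.
Proof. by apply: lt_le_trans one_sub_q; rewrite divr_gt0//; case/andP: halpha. Qed.

(** The previous bound gives 2 / alpha; since alpha <= 1 it is enlarged to the power of alpha in the
    target. *)
Let inv_one_sub_q : (1 - q)^-1 <= 2 / alpha ^+ 2.
Proof.
case/andP: halpha => a0 a1; rewrite -[leRHS]invrK lef_pV2 ?posrE ?invr_gt0 ?divr_gt0 ?exprn_gt0//.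
by rewrite invf_div (le_trans _ one_sub_q)// ler_pM2r// expr2 ler_piMl// ltW//.
Qed.

Let Ea := avgR (fun i => enorm (g0 i - v0 i)).
Let Eb := avgR (fun i => enorm (v0 i - grad (fi i) x0)).
Let kap := sigma + avgR Li * gamma0.

Let Ea_ge0 : 0 <= Ea. Proof. by apply: avgR_ge0 => i; exact: enorm_ge0. Qed.
Let Eb_ge0 : 0 <= Eb. Proof. by apply: avgR_ge0 => i; exact: enorm_ge0. Qed.
Let kap_ge0 : 0 <= kap.
Proof.
rewrite addr_ge0// mulr_ge0// ?(ltW hgamma0)//.
by apply: avgR_ge0 => i; rewrite ltW.
Qed.

Let avg_kap : avgR (fun i => sigma + Li i * gamma0) = kap.
Proof.
rewrite -avgR_D avgR_cst//; congr (_ + _).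
by rewrite [RHS]mulrC avgR_Z; congr avgR; apply/funext => i; rewrite mulrC.
Qed.

Let avg_w1 : avgR w1 = q * (Ea + Eb) + kap.
Proof. by rewrite /w1 -avgR_D avg_kap -avgR_Z -avgR_D. Qed.

Let sum_decay_avg T :
  (1 - q) * \sum_(t < T) gm t.+1 * avgR (fun i => decay q (2 * (sigma + Li i * gamma0)) (w1 i) t)
  <= gamma0 * (q * (Ea + Eb) + kap) + 2 * kap * (gamma0 * har T).
Proof.
under eq_bigr do rewrite avgR_Z.
have -> : \sum_(t < T) avgR (fun i => gm t.+1 * decay q (2 * (sigma + Li i * gamma0)) (w1 i) t) =
    avgR (fun i => \sum_(t < T) gm t.+1 * decay q (2 * (sigma + Li i * gamma0)) (w1 i) t).
  by rewrite /avgR -mulr_sumr exchange_big.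
have -> : gamma0 * (q * (Ea + Eb) + kap) + 2 * kap * (gamma0 * har T) =
    avgR (fun i => gamma0 * w1 i + 2 * (sigma + Li i * gamma0) * (gamma0 * har T)).
  transitivity (avgR (fun i => gamma0 * w1 i) +
      avgR (fun i => 2 * (gamma0 * har T) * (sigma + Li i * gamma0))).
    by rewrite -!avgR_Z avg_w1 avg_kap; ring.
  by rewrite avgR_D; congr avgR; apply/funext => i; ring.
rewrite avgR_Z; apply: ler_avgR => i.
have k0 : 0 <= sigma + Li i * gamma0 by rewrite addr_ge0// mulr_ge0// ltW.
have w10 : 0 <= w1 i by rewrite /w1 addr_ge0// mulr_ge0// addr_ge0 ?enorm_ge0.
have e0 : 0 <= 2 * (sigma + Li i * gamma0) by rewrite mulr_ge0.
have := @sum_decay_le R gamma0 q _ (w1 i) T hgamma0 q_ge0 q_le1 e0 w10.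
rewrite !big_add1/= !big_mkord => /le_trans; apply.
rewrite lerD2l ler_wpM2l// /har mulr_sumr ler_sum// => t _.
exact: gamma_eta_sched_le.
Qed.

Let V0a := V0 alpha gamma0 fi x0 v0 g0.

(** In units of [Lam T], the coefficients collected are 6 for V0, 16 for L gamma0^2, 8 for gamma0
    sigma / sqrt n and 16 for gamma0 [kap] / alpha^2; all are below 20. *)
Let real_bound T :
  3 * Delta + 3 * (L * gamma0 ^+ 2) +
   \sum_(t < T) (2 * (gm t.+1 * (2 * sched_root t.+1 * nu))
     + 2 * (gm t.+1 * avgR (fun i => decay q (2 * (sigma + Li i * gamma0)) (w1 i) t))
     + L * gm t.+1 ^+ 2)
  <= 20 * Lam T * (gamma0 * (V0a / gamma0 + gamma0 * (L + avgR Li / alpha ^+ 2)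
          + sigma * (1 / Num.sqrt n%:R + 1 / alpha ^+ 2))).
Proof.
rewrite !big_split/=.
set S1 := \sum_(t < T) _; set S2 := \sum_(t < T) _; set S3 := \sum_(t < T) _.
have E1 : S1 = 4 * (gamma0 * nu) * har T.
  rewrite /S1 /har mulr_sumr; apply: eq_bigr => t _.
  by rewrite -sched_root4 /gm gamma_schedE; ring.
have E3 : S3 <= L * gamma0 ^+ 2 * har T.
  rewrite /S3 /har mulr_sumr ler_sum// => t _; rewrite -mulrA ler_wpM2l ?(ltW hL)//.
  exact: gamma_sched_sqr_le.
pose B := gamma0 * (q * (Ea + Eb) + kap) + 2 * kap * (gamma0 * har T).
have E2 : S2 <= 2 * (B / (1 - q)).
  by rewrite /S2 -mulr_sumr ler_pM2l// ler_pdivlMr// mulrC; exact: sum_decay_avg.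
pose a2 := (alpha ^+ 2)^-1; have a20 : 0 <= a2 by rewrite invr_ge0 sqr_ge0.
have g00 : 0 <= gamma0 by exact: ltW.
have h0 := har_ge0 T; have h1 := har_le T.
have l1 : 1 <= 2 * Lam T by lra.
have l0' : 0 <= Lam T by lra.
pose y := (1 - q)^-1; have y0 : 0 <= y by rewrite invr_ge0 ltW.
have ya : y <= 2 * a2 by exact: inv_one_sub_q.
have EV : V0a = Delta + 2 * gamma0 * y * Ea + 2 * gamma0 * q * y * Eb by [].
(* In [V0] the initial compression error carries no factor q, so q is given up here. *)
have qE : q * Ea <= Ea by rewrite ler_piMl.
have gyE : 2 * gamma0 * y * (q * Ea) <= 2 * gamma0 * y * Ea by rewrite ler_wpM2l// !mulr_ge0.
have B1 : 2 * (B / (1 - q)) = 2 * gamma0 * y * (q * Ea) + 2 * gamma0 * q * y * Eb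
    + 2 * y * (gamma0 * kap * (1 + 2 * har T)) by rewrite /B -/y; ring.
have gk0 : 0 <= gamma0 * kap by rewrite mulr_ge0.
have B2 : 2 * y * (gamma0 * kap * (1 + 2 * har T)) <= 2 * (2 * a2) * (gamma0 * kap * (4 * Lam T)).
  apply: ler_pM; rewrite ?mulr_ge0//; [by rewrite addr_ge0// mulr_ge0| by rewrite ler_pM2l|].
  by rewrite ler_wpM2l//; lra.
pose r := (Num.sqrt n%:R)^-1 : R; have r0 : 0 <= r by rewrite invr_ge0 sqrtr_ge0.
have EN : gamma0 * (V0a / gamma0 + gamma0 * (L + avgR Li / alpha ^+ 2)
          + sigma * (1 / Num.sqrt n%:R + 1 / alpha ^+ 2)) =
    V0a + L * gamma0 ^+ 2 + gamma0 * sigma * r + gamma0 * kap * a2.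
  rewrite /kap /a2 /r; field.
  by rewrite !gt_eqF ?sqrtr_gt0 ?ltr0n//; case/andP: halpha.
rewrite EN.
have Lg0 : 0 <= L * gamma0 ^+ 2 by rewrite mulr_ge0 ?sqr_ge0// ltW.
have gs0 : 0 <= gamma0 * sigma * r by rewrite !mulr_ge0.
have gka : 0 <= gamma0 * kap * a2 by rewrite mulr_ge0.
have e1 : 0 <= 2 * gamma0 * y * Ea by rewrite mulr_ge0// mulr_ge0// mulr_ge0.
have e2 : 0 <= 2 * gamma0 * q * y * Eb by rewrite mulr_ge0// mulr_ge0// mulr_ge0// mulr_ge0.
have D0 := Delta_ge0.
have V00 : 0 <= V0a by rewrite EV; lra.
have DV : 3 * Delta + 2 * gamma0 * y * (q * Ea) + 2 * gamma0 * q * y * Eb <= 3 * V0a by rewrite EV; lra.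
have E1' : S1 = 4 * har T * (gamma0 * sigma * r + L * gamma0 ^+ 2).
  by rewrite E1 /nu -/r; ring.
have hl : har T <= 2 * Lam T by lra.
have f1 : S1 <= 8 * Lam T * (gamma0 * sigma * r + L * gamma0 ^+ 2).
  by rewrite E1' ler_wpM2r ?addr_ge0//; lra.
have f3 : S3 <= 2 * Lam T * (L * gamma0 ^+ 2).
  by rewrite (le_trans E3)// mulrC ler_wpM2r.
have f4 : V0a <= 2 * Lam T * V0a by rewrite ler_peMl.
have f5 : L * gamma0 ^+ 2 <= 2 * Lam T * (L * gamma0 ^+ 2) by rewrite ler_peMl.
have f6 : 0 <= Lam T * V0a by rewrite mulr_ge0.
have f7 : 0 <= Lam T * (L * gamma0 ^+ 2) by rewrite mulr_ge0.
have f8 : 0 <= Lam T * (gamma0 * sigma * r) by rewrite mulr_ge0.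
have f9 : 0 <= Lam T * (gamma0 * kap * a2) by rewrite mulr_ge0.
move: E2; rewrite B1; lra.
Qed.

Let mean_weighted T : mean_le P (fun w => (\sum_(s < T.+1) gm s)^-1 * \sum_(t < T.+1) gm t * Gf t w)
  (20 * Lam T * ((V0a / gamma0 + gamma0 * (L + avgR Li / alpha ^+ 2)
          + sigma * (1 / Num.sqrt n%:R + 1 / alpha ^+ 2)) / T.+1%:R `^ (1 / 4))).
Proof.
set N := _ + sigma * _.
have SG : gamma0 * T.+1%:R `^ (1 / 4) <= \sum_(s < T.+1) gm s by exact: sum_gamma_sched_ge.
have p0 : 0 < T.+1%:R `^ (1 / 4) :> R by rewrite powR_gt0.
have S0 : 0 < \sum_(s < T.+1) gm s by apply: lt_le_trans SG; rewrite mulr_gt0.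
have mS : mean_le P (fun w => \sum_(t < T.+1) gm t * Gf t w) (20 * Lam T * (gamma0 * N)).
  by apply: le_trans (mean_sum T) _; rewrite lee_fin; exact: real_bound.
have G0 w : 0 <= \sum_(t < T.+1) gm t * Gf t w by apply: sumr_ge0 => t _; rewrite mulr_ge0.
have mG : measurable_fun setT (fun w => \sum_(t < T.+1) gm t * Gf t w).
  by apply: measurable_sum => t; exact: measurable_funM.
have B0 : 0 <= 20 * Lam T * (gamma0 * N).
  rewrite -lee_fin; apply: le_trans mS; apply: integral_ge0 => w _; by rewrite lee_fin.
apply: (@mean_le_mono _ _ _ _ _ (fun w => (gamma0 * T.+1%:R `^ (1 / 4))^-1 *
    \sum_(t < T.+1) gm t * Gf t w)).
- exact: measurable_funM.
- exact: measurable_funM.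
- move=> w; rewrite mulr_ge0 ?invr_ge0 ?(ltW S0)//= ler_wpM2r//.
  by rewrite lef_pV2 ?posrE// mulr_gt0.
have -> : 20 * Lam T * (N / T.+1%:R `^ (1 / 4)) =
    (gamma0 * T.+1%:R `^ (1 / 4))^-1 * (20 * Lam T * (gamma0 * N)).
  by field; rewrite !gt_eqF.
by apply: mean_leZ => //; rewrite invr_ge0 mulr_ge0// ltW.
Qed.

(** The gradient norm at the random index is the sum over t of the indicator of tau = t times the
    norm at x^t. Independence factors each mean, which reproduces the step-size weighted average. *)
Lemma mean_grad_random_index T (tau : Omega -> 'I_T.+1)
    (htau_meas : forall t, measurable (tau @^-1` [set t]))
    (htau_law : forall t : 'I_T.+1, P (tau @^-1` [set t]) =
       (gamma_sched gamma0 t / \sum_(s < T.+1) gamma_sched gamma0 s)%:E)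
    (htau_indep : independent P (preimage_set_system setT tau setT)
       <<s [set A | exists t : 'I_T.+1,
              sigma_of (fun w => pos (St t w) : borel_rV R d) A] >>) :
  mean_le P (fun w => enorm (grad f (pos (St (tau w) w))))
    (20 * (1 + ln (T.+1%:R + 1)) * ((V0 alpha gamma0 fi x0 v0 g0 / gamma0
          + gamma0 * (L + avgR Li / alpha ^+ 2)
          + sigma * (1 / Num.sqrt n%:R + 1 / alpha ^+ 2)) / T.+1%:R `^ (1 / 4))).
Proof.
pose E (t : 'I_T.+1) := tau @^-1` [set t].
(* Writing the gradient of f as an average of the gradients of the clients gives Borel measurability
   from their continuity. *)
pose h (v : 'rV[R]_d) := enorm (avg (fun i => grad (fi i) v)).
have mh : measurable_fun setT (h : borel_rV R d -> R).
  apply: measurable_enorm; apply: measurable_row_avg => i.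
  apply: (measurable_continuous_row (@cfi i)).
  exact/measurable_borel_rVP.
have h0 v : 0 <= h v by exact: enorm_ge0.
have GfE t w : Gf t w = h (pos (St t w)) by rewrite /Gf gradfE.
have key (t : 'I_T.+1) : (\int[P]_w (\1_(E t) w * Gf t w)%:E =
    \int[P]_w (gm t / (\sum_(s < T.+1) gm s) * Gf t w)%:E)%E.
  have c0 : 0 <= gm t / \sum_(s < T.+1) gm s.
    by rewrite divr_ge0// sumr_ge0.
  under [in RHS]eq_integral do rewrite EFinM.
  rewrite ge0_integralZl//; last 2 first.
    - exact/measurable_EFinP/mGf.
    - by move=> w _; rewrite lee_fin.
  rewrite -htau_law.
  have -> : Gf t = h \o (fun w => pos (St t w)) by apply/funext => w; exact: GfE.
  apply: (integral_event_independent (htau_meas t) (ambient_row (@mpos t)) mh h0).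
  move=> B mB; apply: htau_indep; first by exists [set (t : 'I_T.+1)]; rewrite ?setTI.
  by apply: sub_sigma_algebra; exists t, B; rewrite ?setTI.
have mt (t : 'I_T.+1) : measurable_fun setT (fun w => (\1_(E t) w * Gf t w)%:E).
  apply/measurable_EFinP; apply: measurable_funM => //.
  exact/measurable_indic/htau_meas.
have t0 (t : 'I_T.+1) w : (0 <= (\1_(E t) w * Gf t w)%:E)%E by rewrite lee_fin mulr_ge0.
have mt' (t : 'I_T.+1) : measurable_fun setT (fun w => (gm t / (\sum_(s < T.+1) gm s) * Gf t w)%:E).
  by apply/measurable_EFinP; exact: measurable_funM.
have t0' (t : 'I_T.+1) w : (0 <= (gm t / (\sum_(s < T.+1) gm s) * Gf t w)%:E)%E.
  by rewrite lee_fin mulr_ge0// divr_ge0// sumr_ge0.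
have := mean_weighted T; rewrite /mean_le.
have -> : (\int[P]_w (enorm (grad f (pos (St (tau w) w))))%:E =
    \int[P]_w (\sum_(t < T.+1) (\1_(E t) w * Gf t w)%:E))%E.
  apply: eq_integral => w _; rewrite sumEFin (bigD1 (tau w))//=.
  rewrite indicE mem_set// mul1r big1 ?addr0// => t tw.
  rewrite indicE memNset ?mul0r// => /= tauw; move/eqP: tw; apply; exact/esym.
have -> : (\int[P]_w ((\sum_(s < T.+1) gm s)^-1 * \sum_(t < T.+1) gm t * Gf t w)%:E =
    \int[P]_w (\sum_(t < T.+1) (gm t / (\sum_(s < T.+1) gm s) * Gf t w)%:E))%E.
  apply: eq_integral => w _; rewrite sumEFin mulr_sumr; congr _%:E.
  by apply: eq_bigr => t _; rewrite mulrA [_ / _]mulrC.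
rewrite !ge0_integral_sum//.
by under [in X in _ -> X]eq_bigr do rewrite key.
Qed.

End Algorithm.

Theorem theorem1 (R : realType) :
  exists C p : R, 0 < C /\ 0 <= p /\
  forall (n d : nat) (hn : (0 < n)%N)
    (* the stochastic problem *)
    (dX : 'I_n -> measure_display) (X : forall i, measurableType (dX i))
    (D : forall i, probability (X i) R)
    (F : forall i, X i -> 'rV[R]_d -> R) (fi : 'I_n -> 'rV[R]_d -> R)
    (hF_int : forall i x, (D i).-integrable setT (fun a => (F i a x)%:E))
    (hfi : forall i x, ('E_(D i)[fun a => F i a x] = (fi i x)%:E)%E)
    (hF_smooth : forall i a, twice_differentiable (F i a))
    (hfi_smooth : forall i, twice_differentiable (fi i))
    (* the compressors *)
    (dZ : nat -> 'I_n -> measure_display)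
    (Z : forall t i, measurableType (dZ t i))
    (Q : forall t i, probability (Z t i) R)
    (c : forall t i, Z t i -> 'rV[R]_d -> 'rV[R]_d)
    (hc_meas : forall t i, measurable_fun setT
       (fun p : Z t.+1 i * borel_rV R d =>
          (c t.+1 i p.1 (p.2 : 'rV[R]_d) : borel_rV R d)))
    (alpha : R) (halpha : 0 < alpha <= 1)
    (h_contr : forall t i, contractive alpha (Q t.+1 i) (c t.+1 i))
    (* boundedness from below, smoothness, and noise levels *)
    (h_inf : has_lbound (range (fun x => avgR (fi^~ x))))
    (Li : 'I_n -> R) (hLi : forall i, 0 < Li i)
    (hfi_lip : forall i, grad_lipschitz (Li i) (fi i))
    (L : R) (hL : 0 < L)
    (hf_lip : grad_lipschitz L (fun x => avgR (fi^~ x)))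
    (sigma_g sigma_h : R) (hsg : 0 <= sigma_g) (hsh : 0 <= sigma_h)
    (h_grad_mean : forall i x,
       has_mean (D i) (fun a => grad (F i a) x) (grad (fi i) x))
    (h_grad_var : forall i x,
       ('E_(D i)[fun a => (enorm (grad (F i a) x - grad (fi i) x) ^+ 2)%R]
         <= (sigma_g ^+ 2)%:E)%E)
    (h_hess_mean : forall i x,
       has_mean (D i) (fun a => hess (F i a) x) (hess (fi i) x))
    (h_hess_var : forall i x,
       ('E_(D i)[fun a =>
                   (spectral_norm (hess (F i a) x - hess (fi i) x) ^+ 2)%R]
         <= (sigma_h ^+ 2)%:E)%E)
    (* inputs of the algorithm *)
    (gamma0 : R) (hgamma0 : 0 < gamma0)
    (x0 : 'rV[R]_d) (v0 g0 : 'I_n -> 'rV[R]_d)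
    (* samples xi t i, compressor seeds zeta t i, for t >= 1 *)
    (dO : measure_display) (Omega : measurableType dO)
    (P : probability Omega R)
    (xi : nat -> forall i, Omega -> X i)
    (zeta : forall t i, Omega -> Z t i)
    (hxi_law : forall t i, has_law P (xi t.+1 i) (D i))
    (hzeta_law : forall t i, has_law P (zeta t.+1 i) (Q t.+1 i)),
  let St := ef21_sgdm (gamma_sched gamma0) (@eta_sched R) x0 v0 g0 F c xi zeta in
  forall
    (hxi_indep : forall t,
       independent_family P (xi t.+1) (history xi zeta t))
    (hzeta_indep : forall t i,
       independent P (sigma_of (zeta t.+1 i))
         <<s history xi zeta t `|`
             sigma_of (fun w => mom (St t.+1 w) i - est (St t w) i
                                  : borel_rV R d) >>)
    (T : nat) (hT : (1 <= T)%N)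
    (* tau is the random index with xtilde^T = x^tau *)
    (tau : Omega -> 'I_T)
    (htau_meas : forall t, measurable (tau @^-1` [set t]))
    (htau_law : forall t : 'I_T, P (tau @^-1` [set t]) =
       (gamma_sched gamma0 t / \sum_(s < T) gamma_sched gamma0 s)%:E)
    (htau_indep : independent P (preimage_set_system setT tau setT)
       <<s [set A | exists t : 'I_T,
              sigma_of (fun w => pos (St t w) : borel_rV R d) A] >>),
  ('E_P[fun w => enorm (grad (fun x => avgR (fi^~ x)) (pos (St (tau w) w)))]
    <= (C * (1 + ln (T%:R + 1)) `^ p *
        ((V0 alpha gamma0 fi x0 v0 g0 / gamma0
          + gamma0 * (L + avgR Li / alpha ^+ 2)
          + sigma_g * (1 / Num.sqrt n%:R + 1 / alpha ^+ 2))
         / T%:R `^ (1 / 4)))%:E)%E.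
Proof.
(* The constant is that of [real_bound]; the sums have produced a single logarithmic factor. *)
exists 20, 1; split; first by []; split; first by [].
move=> n d hn dX X D F fi hF_int hfi hF_smooth hfi_smooth dZ Z Q c hc_meas alpha
  halpha h_contr h_inf Li hLi hfi_lip L hL hf_lip sigma_g sigma_h hsg hsh
  h_grad_mean h_grad_var h_hess_mean h_hess_var gamma0 hgamma0 x0 v0 g0
  dO Omega P xi zeta hxi_law hzeta_law St hxi_indep hzeta_indep [//|T] hT
  tau htau_meas htau_law htau_indep.
apply/expectation_mean_le; rewrite powRr1; last first.
  by rewrite addr_ge0// ln_ge0// lerDr.
exact: (mean_grad_random_index hn hF_smooth hfi_smooth hc_meas halpha h_contr hLi
  hfi_lip hL hf_lip hsg h_grad_mean h_grad_var hgamma0 hxi_law hzeta_law hxi_indep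
  hzeta_indep h_inf htau_meas htau_law htau_indep).
Qed.
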